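(* Let $L\ge2$, $\mu\in\Lambda$, and assume $b_-(\xi_i,\xi_j)\ne0$ for all $i\neq j$ in $\{1,\dots,L\}$. For $X\in\{A,B,C,D\}$ put $\tilde X_{1\dots L}(\mu)=\mathcal F_{1\dots L}X_{1\dots L}(\mu)\mathcal F_{1\dots L}^{-1}$. Then, writing $\mathrm{diag}(p,q)_i$ for the diagonal matrix with entries $p,q$ acting on $V_i$, $$\tilde D_{1\dots L}(\mu)=\bigotimes_{i=1}^L\mathrm{diag}\big(b_-(\mu,\xi_i),\,a_-(\mu,\xi_i)\big)_i,$$ $$\tilde C_{1\dots L}(\mu)=\sum_{l=1}^Lc_-(\mu,\xi_l)\bigotimes_{i=1}^{l-1}\mathrm{diag}\Big(\tfrac{b_-(\mu,\xi_i)}{b_-(\xi_l,\xi_i)},\,a_-(\mu,\xi_i)\Big)_i\otimes e^{(12)}_l\otimes\bigotimes_{j=l+1}^L\mathrm{diag}\Big(\tfrac{b_-(\mu,\xi_j)}{b_-(\xi_l,\xi_j)},\,\tfrac{a_-(\mu,\xi_j)}{a_-(\xi_l,\xi_j)}\Big)_j,$$ $$\tilde B_{1\dots L}(\mu)=\sum_{l=1}^Lc_+(\mu,\xi_l)\bigotimes_{i=1}^{l-1}\mathrm{diag}\Big(b_-(\mu,\xi_i),\,\tfrac{a_-(\mu,\xi_i)a_-(\xi_i,\xi_l)}{b_-(\xi_i,\xi_l)}\Big)_i\otimes e^{(21)}_l\otimes\bigotimes_{j=l+1}^L\mathrm{diag}\Big(b_-(\mu,\xi_j),\,\tfrac{a_-(\mu,\xi_j)}{b_-(\xi_j,\xi_l)}\Big)_j,$$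 and, if moreover $b_-(\mu,\xi_i)\neq0$ and $b_-(\xi_i,\mu)\ne0$ for all $i$, $$\tilde A_{1\dots L}(\mu)=\bigotimes_{i=1}^L\mathrm{diag}\Big(1,\,\tfrac1{b_-(\xi_i,\mu)}\Big)_i+\tilde B_{1\dots L}(\mu)\,\tilde D_{1\dots L}(\mu)^{-1}\,\tilde C_{1\dots L}(\mu).$$
   Context: Weights. Let $\Lambda$ be a set and $a_-,b_\pm,c_\pm:\Lambda\times\Lambda\to\mathbb C$ functions. Let $R(\lambda_1,\lambda_2)\in\mathrm{End}(\mathbb C^2\otimes\mathbb C^2)$ be, in the ordered basis $(e_1\otimes e_1,e_1\otimes e_2,e_2\otimes e_1,e_2\otimes e_2)$, $$R=\begin{pmatrix}1&0&0&0\\0&b_+&c_+&0\\0&c_-&b_-&0\\0&0&0&a_-\end{pmatrix}(\lambda_1,\lambda_2).$$ For labelled copies $V_i\cong\mathbb C^2$, $R_{ij}(\lambda,\lambda')$ denotes $R(\lambda,\lambda')$ acting on $V_i\otimes V_j$ (first tensor factor $=V_i$, second $=V_j$) and trivially elsewhere. Standing assumptions, for all $\lambda_i\in\Lambda$: unitarity $R_{12}(\lambda_1,\lambda_2)R_{21}(\lambda_2,\lambda_1)=I$, and the Yang-Baxter equation $R_{12}(\lambda_1,\lambda_2)R_{13}(\lambda_1,\lambda_3)R_{23}(\lambda_2,\lambda_3)=R_{23}(\lambda_2,\lambda_3)R_{13}(\lambda_1,\lambda_3)R_{12}(\lambda_1,\lambda_2)$. (Unitarity gives $a_-(\lambda,\lambda')a_-(\lambda',\lambda)=1$.)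 Fix $\xi_1,\dots,\xi_L\in\Lambda$, $\xi_i$ attached to $V_i$; write $R_{ij}=R_{ij}(\xi_i,\xi_j)$. $e^{(kl)}_i$ is the $2\times2$ matrix unit (1 in entry $(k,l)$) acting on $V_i$. Monodromy matrix. With an auxiliary space $V_a\cong\mathbb C^2$, $\mathcal T_{a,1\dots L}(\mu)=R_{aL}(\mu,\xi_L)\cdots R_{a1}(\mu,\xi_1)=\begin{pmatrix}A_{1\dots L}(\mu)&B_{1\dots L}(\mu)\\C_{1\dots L}(\mu)&D_{1\dots L}(\mu)\end{pmatrix}_a$, a $2\times2$ matrix in $V_a$ with entries in $\mathrm{End}(V_1\otimes\dots\otimes V_L)$. Definition of $\mathcal F$. $R_{i,(i+1)\dots L}=R_{iL}R_{i(L-1)}\cdots R_{i(i+1)}$; $\mathcal F_{i,(i+1)\dots L}=e^{(11)}_i+e^{(22)}_iR_{i,(i+1)\dots L}$; $\mathcal F_{1\dots L}=\mathcal F_{(L-1),L}\,\mathcal F_{(L-2),(L-1)L}\cdots\mathcal F_{1,2\dots L}$. It is invertible when the $b_-(\xi_i,\xi_j)$, $i\neq j$, are nonzero. *)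

(* Defs.v *)
From mathcomp Require Import all_boot all_order all_algebra.
From mathcomp Require Import reals complex.

Set Implicit Arguments.
Unset Strict Implicit.
Unset Printing Implicit Defensive.

Import GRing.Theory.
Local Open Scope ring_scope.

(* The space (K^2)^{(x) I}, for a finite set I of sites, has the basis
   (x)_{i in I} e_{s i}, indexed by s : conf I; the values 0, 1 : 'I_2 stand
   for e_1, e_2. Operators are matrices in this basis: the column of index t
   is the image of the basis vector of index t. *)
Definition conf (I : finType) := {ffun I -> 'I_2}.

Section Operators.
Variable K : fieldType.

Definition opr (I : finType) := 'M[K]_#|{: conf I}|.

Definition opr_of (I : finType) (f : conf I -> conf I -> K) : opr I :=
  \matrix_(s, t) f (enum_val s) (enum_val t).

Definition tensor_op (I : finType) (M : I -> 'M[K]_2) : opr I :=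
  opr_of (fun s t => \prod_i M i (s i) (t i)).

Definition site_op (I : finType) (i : I) (M : 'M[K]_2) : opr I :=
  tensor_op (fun j => if j == i then M else 1%:M).

(* Position in (e1 (x) e1, e1 (x) e2, e2 (x) e1, e2 (x) e2). *)
Definition pair_idx (k l : 'I_2) : 'I_4 := inord (2 * k + l)%N.

(* Only meaningful for i != j; the first tensor factor of M is site i. *)
Definition two_site_op (I : finType) (i j : I) (M : 'M[K]_4) : opr I :=
  opr_of (fun s t =>
    M (pair_idx (s i) (s j)) (pair_idx (t i) (t j))
    * [forall k, (k != i) && (k != j) ==> (s k == t k)]%:R).

Definition diag2 (p q : K) : 'M[K]_2 := diag_mx (\row_j [:: p; q]`_j).

(* The matrix units e^(kl), with k, l in {1, 2}. *)
Definition e11 : 'M[K]_2 := delta_mx 0 0.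
Definition e12 : 'M[K]_2 := delta_mx 0 1.
Definition e21 : 'M[K]_2 := delta_mx 1 0.
Definition e22 : 'M[K]_2 := delta_mx 1 1.

End Operators.

Record weights (Lam : Type) (K : fieldType) := Weights {
  am : Lam -> Lam -> K;
  bp : Lam -> Lam -> K;
  bm : Lam -> Lam -> K;
  cp : Lam -> Lam -> K;
  cm : Lam -> Lam -> K }.

Section Model.
Variables (K : fieldType) (Lam : Type) (w : weights Lam K).

Definition Rmat (x y : Lam) : 'M[K]_4 :=
  \matrix_(r, c)
    (nth [::] [:: [:: 1; 0;        0;        0       ];
                  [:: 0; bp w x y; cp w x y; 0       ];
                  [:: 0; cm w x y; bm w x y; 0       ];
                  [:: 0; 0;        0;        am w x y]] r)`_c.

Definition Rop (I : finType) (i j : I) (x y : Lam) : opr K I :=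
  two_site_op i j (Rmat x y).

Definition unitarity : Prop :=
  let s1 : 'I_2 := inord 0 in let s2 : 'I_2 := inord 1 in
  forall x1 x2 : Lam, Rop s1 s2 x1 x2 *m Rop s2 s1 x2 x1 = 1%:M.

Definition yang_baxter : Prop :=
  let s1 : 'I_3 := inord 0 in
  let s2 : 'I_3 := inord 1 in
  let s3 : 'I_3 := inord 2 in
  forall x1 x2 x3 : Lam,
    Rop s1 s2 x1 x2 *m Rop s1 s3 x1 x3 *m Rop s2 s3 x2 x3
    = Rop s2 s3 x2 x3 *m Rop s1 s3 x1 x3 *m Rop s1 s2 x1 x2.

Variables (L : nat) (xi : 'I_L -> Lam).

(* The products below are ordered, with the site index decreasing from left
   to right; sites are numbered from 0. *)

(* The auxiliary space V_a is the site None. *)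
Definition monodromy (mu : Lam) : opr K (option 'I_L) :=
  \prod_(j <- rev (enum 'I_L)) Rop None (Some j) mu (xi j).

Definition extend_conf (k : 'I_2) (s : conf 'I_L) : conf (option 'I_L) :=
  [ffun o => if o is Some i then s i else k].

(* Entry (k, l) of an operator read as a 2 x 2 matrix in V_a. *)
Definition aux_block (T : opr K (option 'I_L)) (k l : 'I_2) : opr K 'I_L :=
  opr_of (fun s t =>
    T (enum_rank (extend_conf k s)) (enum_rank (extend_conf l t))).

Definition opA (mu : Lam) : opr K 'I_L := aux_block (monodromy mu) 0 0.
Definition opB (mu : Lam) : opr K 'I_L := aux_block (monodromy mu) 0 1.
Definition opC (mu : Lam) : opr K 'I_L := aux_block (monodromy mu) 1 0.
Definition opD (mu : Lam) : opr K 'I_L := aux_block (monodromy mu) 1 1.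

(* R_{i,(i+1)...L} *)
Definition Rtail (i : 'I_L) : opr K 'I_L :=
  \prod_(j <- rev (enum 'I_L) | (i < j)%N) Rop i j (xi i) (xi j).

(* F_{i,(i+1)...L} *)
Definition Fpart (i : 'I_L) : opr K 'I_L :=
  site_op i (e11 K) + site_op i (e22 K) *m Rtail i.

(* F_{1...L} *)
Definition Ftwist : opr K 'I_L :=
  \prod_(i <- rev (enum 'I_L) | (i.+1 < L)%N) Fpart i.

Definition twisted (X : opr K 'I_L) : opr K 'I_L :=
  Ftwist *m X *m invmx Ftwist.

End Model.

(* Main.v *)
Require Import Defs.
From HB Require Import structures.
From mathcomp Require Import all_boot all_order all_algebra.
From mathcomp Require Import reals complex.
From mathcomp Require Import ring.

Set Implicit Arguments.
Unset Strict Implicit.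
Unset Printing Implicit Defensive.

Import GRing.Theory.
Local Open Scope ring_scope.

(** The proof is by induction on L, splitting off the first site. As 2 x 2
    block matrices over V_1, with ' denoting the chain on the sites 2..L and
    F' = F_{2..L}, one has F = [[F', 0], [F' C'(xi_1), F' D'(xi_1)]], and the
    blocks of A, B, C, D are weights times A', B', C', D'. The claimed
    formulas for D, C and B then reduce, block by block, to components of the
    exchange relations R T T = T T R and, for the sums over l, to a component
    of the Yang-Baxter equation combined with unitarity.
    For A, consider the inverse monodromy matrix: its entry (1,1) is twisted,
    by the same induction, into the tensor product E of the
    diag(1, b_-(xi_i, mu)). By the Schur complement formula
    E (A - B D^-1 C) = 1 in the twisted basis, which is the formula for A.
    The induction step for B uses the formula for A' at the point xi_1, where
    its nonvanishing conditions hold by hypothesis. *)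

(** * Operators in the tensor basis *)

Section Entries.
Variables (K : fieldType) (I : finType).
Implicit Types (X Y : opr K I) (s t : conf I).

Definition entry X s t : K := X (enum_rank s) (enum_rank t).

Lemma entry_opr_of f s t : entry (opr_of f) s t = f s t.
Proof. by rewrite /entry mxE !enum_rankK. Qed.

Lemma entry_inj X Y : (forall s t, entry X s t = entry Y s t) -> X = Y.
Proof.
move=> eqXY; apply/matrixP => a b.
by have := eqXY (enum_val a) (enum_val b); rewrite /entry !enum_valK.
Qed.

Lemma entry_mul X Y s t :
  entry (X *m Y) s t = \sum_u entry X s u * entry Y u t.
Proof.
rewrite /entry mxE (reindex_onto enum_rank enum_val) /=; last first.
  by move=> a _; rewrite enum_valK.
by apply: eq_bigl => u; rewrite enum_rankK eqxx.
Qed.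

Lemma entry1 s t : entry 1%:M s t = (s == t)%:R.
Proof. by rewrite /entry mxE (inj_eq enum_rank_inj). Qed.

Lemma entry_tensor (M : I -> 'M[K]_2) s t :
  entry (tensor_op M) s t = \prod_i M i (s i) (t i).
Proof. exact: entry_opr_of. Qed.

Lemma tensor_mul (M N : I -> 'M[K]_2) :
  tensor_op M *m tensor_op N = tensor_op (fun i => M i *m N i).
Proof.
apply: entry_inj => s t; rewrite entry_mul entry_tensor.
transitivity (\sum_(u : conf I) \prod_i (M i (s i) (u i) * N i (u i) (t i))).
  by apply: eq_bigr => u _; rewrite !entry_tensor -big_split.
(* A sum over configurations of a product over sites is the product over sites of sums over a single
   index. *)
rewrite -(bigA_distr_bigA (fun i u => M i (s i) u * N i u (t i))).
by apply: eq_bigr => i _; rewrite mxE.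
Qed.

Lemma tensor1 : tensor_op (fun _ : I => 1%:M) = 1%:M :> opr K I.
Proof.
apply: entry_inj => s t; rewrite entry_tensor entry1.
have [->|/eqP neq_st] := eqVneq s t.
  by rewrite big1 // => i _; rewrite mxE eqxx.
case: (pickP (fun i => s i != t i)) => [i neq_i|eq_st].
  by rewrite (bigD1 i) //= mxE (negbTE neq_i) mul0r.
by case: neq_st; apply/ffunP => i; apply/eqP/negbFE/eq_st.
Qed.

Lemma eq_tensor (M N : I -> 'M[K]_2) : M =1 N -> tensor_op M = tensor_op N.
Proof.
move=> eqMN; apply: entry_inj => s t; rewrite !entry_tensor.
by apply: eq_bigr => i _; rewrite eqMN.
Qed.

Lemma site_mul (i : I) (M N : 'M[K]_2) :
  site_op i M *m site_op i N = site_op i (M *m N).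
Proof.
by rewrite tensor_mul; apply: eq_tensor => j; case: ifP; rewrite ?mul1mx.
Qed.

Lemma site_comm (i j : I) (M N : 'M[K]_2) : i != j ->
  site_op i M *m site_op j N = site_op j N *m site_op i M.
Proof.
move=> neq_ij; rewrite !tensor_mul; apply: eq_tensor => k.
have [->|_] := eqVneq k i; last by rewrite mul1mx mulmx1.
by rewrite (negbTE neq_ij) mul1mx mulmx1.
Qed.

Lemma site1 (i : I) : site_op i 1%:M = 1%:M :> opr K I.
Proof. by rewrite -tensor1; apply: eq_tensor => j; case: ifP. Qed.

Lemma site_linear (i : I) : linear (@site_op K I i).
Proof.
move=> a M N; apply: entry_inj => s t.
rewrite /entry !mxE -/(entry _ _ _) !enum_rankK (bigD1 i) //=.
rewrite [in RHS](bigD1 i) //= [X in _ = _ + X](bigD1 i) //= eqxx !mxE.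
rewrite mulrDl mulrA; congr (_ * _ + _ * _);
  by apply: eq_bigr => j /negbTE ->.
Qed.

HB.instance Definition _ (i : I) :=
  GRing.isLinear.Build K 'M[K]_2 'M[K]_#|{: conf I}| _ (@site_op K I i)
    (site_linear i).
End Entries.

(** * Splitting off a site *)

(* The bijection h, of inverse g, exhibits J as I plus one site h None. *)
Section Blocks.
Variables (K : fieldType) (I J : finType).
Variables (h : option I -> J) (g : J -> option I).
Hypotheses (hK : cancel h g) (gK : cancel g h).
Implicit Types (X Y : opr K J) (s t : conf I) (k l : 'I_2).

Definition ext k s : conf J := [ffun o => if g o is Some i then s i else k].

Lemma extN k s : ext k s (h None) = k.
Proof. by rewrite ffunE hK. Qed.

Lemma extS k s i : ext k s (h (Some i)) = s i.
Proof. by rewrite ffunE hK. Qed.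

Lemma ext_eta (c : conf J) : ext (c (h None)) [ffun i => c (h (Some i))] = c.
Proof.
by apply/ffunP => o; rewrite ffunE -[in RHS](gK o); case: (g o) => // i;
  rewrite ffunE.
Qed.

Lemma ext_eq k s l t : (ext k s == ext l t) = (k == l) && (s == t).
Proof.
apply/eqP/andP => [eq_e|[/eqP-> /eqP->] //]; split; apply/eqP.
  by rewrite -(extN k s) eq_e extN.
by apply/ffunP => i; rewrite -(extS k s i) eq_e extS.
Qed.

Lemma sum_ext (f : conf J -> K) : \sum_c f c = \sum_k \sum_s f (ext k s).
Proof.
rewrite pair_big /= (reindex (fun p : 'I_2 * conf I => ext p.1 p.2)) //=.
exists (fun c => (c (h None), [ffun i => c (h (Some i))])) => [[k s] _|c _] /=.
  by rewrite extN; congr pair; apply/ffunP => i; rewrite ffunE extS.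
exact: ext_eta.
Qed.

(** Two splittings occur below: with [h] the identity of [option 'I_L] the auxiliary space is split
    off, with [ord_join] the first site of a chain. *)
Definition toblk X : 'M[opr K I]_2 :=
  \matrix_(k, l) opr_of (fun s t => entry X (ext k s) (ext l t)).

Lemma entry_toblk X k l s t :
  entry (toblk X k l) s t = entry X (ext k s) (ext l t).
Proof. by rewrite mxE entry_opr_of. Qed.

Lemma toblk_inj : injective toblk.
Proof.
move=> X Y /matrixP eqXY; apply: entry_inj => s t.
by rewrite -[s]ext_eta -[t]ext_eta -!entry_toblk eqXY.
Qed.

Lemma toblk_is_additive : {morph toblk : X Y / X + Y}.
Proof.
move=> X Y; apply/matrixP => k l; apply: entry_inj => s t.
by rewrite !mxE /entry !mxE.
Qed.

Lemma toblk_mul : {morph toblk : X Y / X *m Y >-> X * Y}.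
Proof.
move=> X Y; apply/matrixP => k l; apply: entry_inj => s t.
rewrite entry_toblk entry_mul sum_ext mxE.
rewrite /entry summxE; apply: eq_bigr => m _;
  rewrite -!/(entry _ _ _) entry_mul.
by apply: eq_bigr => u _; rewrite !entry_toblk.
Qed.

Lemma toblk1 : toblk 1%:M = 1.
Proof.
apply/matrixP => k l; apply: entry_inj => s t.
rewrite entry_toblk entry1 ext_eq mxE; case: (k == l); first by rewrite entry1.
by rewrite /entry !mxE.
Qed.

End Blocks.

Section BlockValues.
Variables (K : fieldType) (I J : finType).
Variables (h : option I -> J) (g : J -> option I).
Hypotheses (hK : cancel h g) (gK : cancel g h).
Implicit Types (s t : conf I) (k l : 'I_2).

Lemma toblk_tensor (M : J -> 'M[K]_2) k l :
  toblk g (tensor_op M) k l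
  = M (h None) k l *: tensor_op (fun i => M (h (Some i))).
Proof.
apply: entry_inj => s t; rewrite entry_toblk // entry_tensor.
rewrite [RHS]mxE -/(entry _ _ _) entry_tensor (bigD1 (h None)) //= !(extN hK).
congr (_ * _); rewrite (reindex_omap (h \o Some) g) => [|o /eqP neq_o] /=.
  apply: eq_big => [i|i _]; last by rewrite !(extS hK).
  by rewrite (can_eq hK) hK eqxx.
by move: (gK o); case: (g o) => [i|] /= go; [rewrite go|case: neq_o].
Qed.

Lemma toblk_siteN (M : 'M[K]_2) :
  toblk g (site_op (h None) M) = map_mx scalar_mx M.
Proof.
apply/matrixP => k l; rewrite toblk_tensor eqxx [RHS]mxE -[RHS]scalemx1;
  congr (_ *: _).
by rewrite -tensor1; apply: eq_tensor => i; rewrite (can_eq hK).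
Qed.

Lemma toblk_siteS i (M : 'M[K]_2) :
  toblk g (site_op (h (Some i)) M) = (site_op i M)%:M.
Proof.
apply/matrixP => k l; rewrite toblk_tensor (can_eq hK) /= [in RHS]mxE mxE.
rewrite -scaler_nat; congr (_ *: _); apply: eq_tensor => j.
by rewrite (can_eq hK).
Qed.

Variables (Lam : Type) (w : weights Lam K).

Lemma toblk_RopS (i j : I) x y :
  toblk g (Rop w (h (Some i)) (h (Some j)) x y) = (Rop w i j x y)%:M.
Proof.
apply/matrixP => k l; apply: entry_inj => s t;
  rewrite entry_toblk // entry_opr_of.
rewrite [in RHS]mxE; set b := [forall _, _].
(* The agreement required off the two sites also binds the split-off site, which makes the block
   matrix diagonal. *)
have -> : b = (k == l) && [forall o, (o != i) && (o != j) ==> (s o == t o)].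
  apply/forallP/andP => [eq_st|[/eqP-> /forallP eq_st] o].
    split; first by have := eq_st (h None); rewrite !(can_eq hK) !(extN hK).
    by apply/forallP => o; have := eq_st (h (Some o));
      rewrite !(can_eq hK) !(extS hK).
  rewrite -[o]gK; case: (g o) => [o'|];
    first by rewrite !(can_eq hK) !(extS hK); apply: eq_st.
  by rewrite !(extN hK) eqxx implybT.
case: (k == l); rewrite /= ?mulr0.
  by rewrite mulr1n entry_opr_of !(extS hK).
by rewrite mulr0n /entry mxE.
Qed.

Definition Rw x y (k k' l l' : 'I_2) : K :=
  Rmat w x y (pair_idx k k') (pair_idx l l').

(* R_aj and R_ja, as 2 x 2 matrices over the auxiliary space a, indexed by
   k and l, with entries in End(V_j). *)
Definition Lmx x y : 'M['M[K]_2]_2 := \matrix_(k, l) \matrix_(s, t) Rw x y k s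
  l t.

Definition Lmx' x y : 'M['M[K]_2]_2 := \matrix_(k, l) \matrix_(s, t) Rw x y s k
  t l.

(** Serves $R_{aj}$ and $R_{ja}$ alike: [f] holds the weights with their arguments already arranged
    for either order of the two sites. *)
Lemma toblk_pair (f : 'I_2 -> 'I_2 -> 'I_2 -> 'I_2 -> K) (X : opr K J) (j : I) :
    (forall s t : conf J, entry X s t
     = f (s (h None)) (s (h (Some j))) (t (h None)) (t (h (Some j)))
       * [forall o, (o != h None) && (o != h (Some j)) ==> (s o == t o)]%:R) ->
  toblk g X = \matrix_(k, l) site_op j (\matrix_(s, t) f k s l t).
Proof.
move=> entryX; apply/matrixP => k l; apply: entry_inj => s t.
rewrite entry_toblk // entryX.
rewrite [in RHS]mxE entry_tensor (bigD1 j) //= eqxx [in RHS]mxE.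
rewrite !(extS hK) !(extN hK); congr (_ * _).
set b := [forall _, _].
have -> : b = [forall o, (o != j) ==> (s o == t o)].
  apply/forallP/forallP => eq_st o.
    by have := eq_st (h (Some o)); rewrite !(can_eq hK) !(extS hK).
  rewrite -[o]gK; case: (g o) => [o'|];
    rewrite ?eqxx // !(can_eq hK) !(extS hK).
  exact: eq_st.
have [/forallP eq_st|/forallPn[o]] := boolP [forall o, (o != j) ==> (s o == t
  o)].
  rewrite big1 // => o neq_oj; have := eq_st o; rewrite (negbTE neq_oj) /=.
  by rewrite mxE => ->.
rewrite negb_imply => /andP[neq_oj neq_st].
by rewrite (bigD1 o) //= (negbTE neq_oj) mxE (negbTE neq_st) mul0r.
Qed.

Lemma toblk_RopN (j : I) x y :
  toblk g (Rop w (h None) (h (Some j)) x y) = map_mx (site_op j) (Lmx x y).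
Proof.
rewrite (toblk_pair (f := Rw x y) (j := j)) => [|c d]; last exact: entry_opr_of.
by apply/matrixP => k l; rewrite !mxE.
Qed.

Lemma toblk_RopN' (j : I) x y :
  toblk g (Rop w (h (Some j)) (h None) x y) = map_mx (site_op j) (Lmx' x y).
Proof.
rewrite (toblk_pair (f := fun k k1 l l1 => Rw x y k1 k l1 l) (j := j)) => [|c
  d].
  by apply/matrixP => k l; rewrite !mxE.
rewrite entry_opr_of; congr (_ * (nat_of_bool _)%:R).
by apply: eq_forallb => o; rewrite andbC.
Qed.

End BlockValues.

(** Together with linearity this makes [site_op i] a ring morphism, so that [map_mx (site_op i)]
    respects products of 2 x 2 block matrices. *)
HB.instance Definition _ (K : fieldType) (I : finType) (i : I) :=
  GRing.isMonoidMorphism.Build 'M[K]_2 'M[K]_#|{: conf I}| (@site_op K I i)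
    (site1 K i, fun M N => esym (site_mul i M N)).

Lemma site_scalar (K : fieldType) (I : finType) (i : I) (c : K) :
  site_op i c%:M = c%:M.
Proof. by rewrite -scalemx1 linearZ /= site1 scalemx1. Qed.

(** * Splitting off the first site of a chain *)

Section OrdSplit.
Variables (K : fieldType) (n : nat).

Definition ord_join (o : option 'I_n) : 'I_n.+1 := oapp (lift ord0) ord0 o.

Lemma ord_joinK : cancel ord_join (unlift ord0).
Proof. by case=> [i|]; rewrite /= ?liftK ?unlift_none. Qed.

Lemma unlift0K : cancel (unlift ord0) ord_join.
Proof. by move=> i; case: unliftP => [j|] ->. Qed.

Definition hsplit (X : opr K 'I_n.+1) : 'M[opr K 'I_n]_2 :=
  toblk (unlift ord0) X.

Lemma hsplit_inj : injective hsplit.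
Proof. exact: toblk_inj unlift0K. Qed.

(** Needed to turn a block inverse of the twist back into an operator on the chain. *)
Definition hjoin (M : 'M[opr K 'I_n]_2) : opr K 'I_n.+1 :=
  opr_of (fun s t => entry (M (s ord0) (t ord0))
                       [ffun i => s (lift ord0 i)] [ffun i => t (lift ord0 i)]).

Lemma hjoinK : cancel hjoin hsplit.
Proof.
move=> M; apply/matrixP => k l; apply: entry_inj => s t.
rewrite entry_toblk entry_opr_of.
have ext0 m (c : conf 'I_n) : ext (unlift ord0) m c ord0 = m := extN ord_joinK
  m c.
have extS0 m (c : conf 'I_n) : [ffun i : 'I_n => ext (unlift ord0) m c (lift
  ord0 i)] = c.
  by apply/ffunP => i; rewrite ffunE; exact: (extS ord_joinK m c i).
by rewrite !ext0 !extS0.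
Qed.

Lemma hsplit_additive : nmod_morphism hsplit.
Proof.
split; last exact: toblk_is_additive.
by apply/matrixP => k l; apply: entry_inj => s t; rewrite !mxE /entry !mxE.
Qed.

Lemma hsplit_multiplicative : monoid_morphism hsplit.
Proof.
by split; [exact: toblk1 ord_joinK | exact: toblk_mul ord_joinK unlift0K].
Qed.

HB.instance Definition _ :=
  GRing.isNmodMorphism.Build
    'M[K]_#|{: conf 'I_n.+1}| 'M['M[K]_#|{: conf 'I_n}|]_2
    hsplit hsplit_additive.
HB.instance Definition _ :=
  GRing.isMonoidMorphism.Build
    'M[K]_#|{: conf 'I_n.+1}| 'M['M[K]_#|{: conf 'I_n}|]_2
    hsplit hsplit_multiplicative.

Lemma hsplitZ a X k l : hsplit (a *: X) k l = a *: hsplit X k l.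
Proof.
by apply: entry_inj => s t;
  rewrite entry_toblk [RHS]mxE -/(entry _ _ _) entry_toblk [LHS]mxE.
Qed.

Lemma hsplit_site0 (M : 'M[K]_2) :
  hsplit (site_op ord0 M) = map_mx scalar_mx M.
Proof. exact: (toblk_siteN ord_joinK unlift0K). Qed.

Lemma hsplit_lift i (M : 'M[K]_2) :
  hsplit (site_op (lift ord0 i) M) = (site_op i M)%:M.
Proof. exact: (toblk_siteS ord_joinK unlift0K). Qed.

Lemma hsplit_tensor (M : 'I_n.+1 -> 'M[K]_2) k l :
  hsplit (tensor_op M) k l
  = M ord0 k l *: tensor_op (fun i => M (lift ord0 i)).
Proof. exact: (toblk_tensor ord_joinK unlift0K). Qed.

Variables (Lam : Type) (w : weights Lam K).

Lemma hsplit_Rop_lift i j x y :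
  hsplit (Rop w (lift ord0 i) (lift ord0 j) x y) = (Rop w i j x y)%:M.
Proof. exact: (toblk_RopS ord_joinK unlift0K). Qed.

Lemma hsplit_Rop0 j x y :
  hsplit (Rop w ord0 (lift ord0 j) x y) = map_mx (site_op j) (Lmx w x y).
Proof. exact: (toblk_RopN ord_joinK unlift0K). Qed.

Lemma hsplit_Rop0' j x y :
  hsplit (Rop w (lift ord0 j) ord0 x y) = map_mx (site_op j) (Lmx' w x y).
Proof. exact: (toblk_RopN' ord_joinK unlift0K). Qed.

End OrdSplit.

(** Lets relations between operators on a one-site chain be read back as relations between 2 x 2
    matrices: the blocks over that site are scalars on the empty chain. *)
Lemma site_op_inj (K : fieldType) : injective (@site_op K 'I_1 ord0).
Proof.
move=> M N /(congr1 (@hsplit K 0)); rewrite !hsplit_site0 => /matrixP eqMN.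
apply/matrixP => k l; have := eqMN k l; rewrite !mxE.
pose s : conf 'I_0 := [ffun=> ord0].
move=> /(congr1 (fun X : opr K 'I_0 => entry X s s)).
by rewrite /entry !mxE eqxx.
Qed.

Lemma map_mx_inj_of (A B : Type) m n (f : A -> B) :
  injective f -> injective (map_mx f : 'M_(m, n) -> 'M_(m, n)).
Proof.
move=> f_inj M N /matrixP eqMN; apply/matrixP => i j.
by apply: f_inj; have := eqMN i j; rewrite !mxE.
Qed.

(** * Exchange relations *)

Section Nested.
Variables (K : fieldType) (N : nat).

(* Operators on a pair of auxiliary spaces a, b are 2 x 2 matrices, indexed by
   a, of 2 x 2 matrices, indexed by b. *)
Definition aop (T : 'M['M[K]_N]_2) : 'M['M['M[K]_N]_2]_2 := map_mx scalar_mx T.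
Definition bop (T : 'M['M[K]_N]_2) : 'M['M['M[K]_N]_2]_2 := T%:M.
Definition rop (r : 'M['M[K]_2]_2) : 'M['M['M[K]_N]_2]_2 :=
  map_mx (map_mx scalar_mx) r.

Lemma aopM S T : aop (S *m T) = aop S *m aop T.
Proof. by rewrite /aop map_mxM. Qed.

Lemma bopM S T : bop (S *m T) = bop S *m bop T.
Proof. by rewrite /bop scalar_mxM. Qed.

Lemma ropM S T : rop (S *m T) = rop S *m rop T.
Proof. by rewrite /rop !map_mxM. Qed.

End Nested.

Lemma mul_scalar_mxE (A : pzRingType) m n a (X : 'M[A]_(m, n)) i j :
  (a%:M *m X) i j = a * X i j.
Proof. by rewrite mul_scalar_mx mxE. Qed.

Lemma mul_mx_scalarE (A : pzRingType) m n a (X : 'M[A]_(m, n)) i j :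
  (X *m a%:M) i j = X i j * a.
Proof. by rewrite -diag_const_mx mul_mx_diag !mxE. Qed.

Section Exchange.
Variable A : pzRingType.
Implicit Types r s t : A.

(** The step of the train argument: factors of different sites commute past each other, so [r] can
    be carried through one site at a time. *)
Lemma exchange_mul r s s' t t' :
    s * t' = t' * s -> t * s' = s' * t ->
    r * s * s' = s' * s * r -> r * t * t' = t' * t * r ->
  r * (s * t) * (s' * t') = s' * t' * (s * t) * r.
Proof.
move=> cst cts rs rt.
transitivity (r * s * s' * (t * t')).
  by rewrite -!mulrA; congr (_ * (_ * _)); rewrite !mulrA cts.
rewrite rs -!mulrA [r * _]mulrA rt -!mulrA; congr (_ * _).
by rewrite !mulrA cst.
Qed.

(** The exchange relation is multiplied on both sides by $r^{-1}$, then on both sides by $t^{-1}$,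
    which is [s]. *)
Lemma exchange_inv r r' t s t' :
    r * r' = 1 -> r' * r = 1 -> s * t = 1 -> t * s = 1 ->
  r * t * t' = t' * t * r -> t' * r' * s = s * r' * t'.
Proof.
move=> rK Kr st ts rtt.
have {rtt} e : t * t' * r' = r' * t' * t.
  rewrite -[LHS]mul1r -Kr -[RHS]mulr1 -[X in _ = _ * X]rK.
  by rewrite -!mulrA; congr (_ * _); rewrite !mulrA rtt.
rewrite -[LHS]mul1r -st -[RHS]mulr1 -[X in _ = _ * X]ts.
by rewrite -!mulrA; congr (_ * _); rewrite !mulrA e.
Qed.
End Exchange.

Section RTT.
Variables (K : fieldType) (N : nat).
Implicit Types (S T : 'M['M[K]_N]_2) (r : 'M['M[K]_2]_2).

Definition rtt r T T' :=
  rop N r *m aop T *m bop T' = bop T' *m aop T *m rop N r.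

Definition commuting T S := aop T *m bop S = bop S *m aop T.

Lemma commutingP T S :
  (forall k l k' l', T k l *m S k' l' = S k' l' *m T k l) -> commuting T S.
Proof.
move=> commTS; apply/matrixP => k l.
rewrite mul_mx_scalarE mul_scalar_mxE mxE; apply/matrixP => k' l'.
by rewrite [LHS]mul_scalar_mxE [RHS]mul_mx_scalarE; apply: commTS.
Qed.

Lemma commutingMl T1 T2 S :
  commuting T1 S -> commuting T2 S -> commuting (T1 *m T2) S.
Proof.
by rewrite /commuting aopM => c1 c2; rewrite -mulmxA c2 mulmxA c1 -!mulmxA.
Qed.

Lemma commutingMr T S1 S2 :
  commuting T S1 -> commuting T S2 -> commuting T (S1 *m S2).
Proof.
by rewrite /commuting bopM => c1 c2; rewrite mulmxA c1 -mulmxA c2 mulmxA.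
Qed.

Lemma rttM r S S' T T' :
    commuting S T' -> commuting T S' ->
  rtt r S S' -> rtt r T T' -> rtt r (S *m T) (S' *m T').
Proof.
rewrite /rtt /commuting !aopM !bopM => cST cTS rS rT.
exact: exchange_mul.
Qed.

Lemma rtt_inv r r' S T T' :
    r *m r' = 1%:M -> r' *m r = 1%:M -> S *m T = 1%:M -> T *m S = 1%:M ->
  rtt r T T' ->
  bop T' *m rop N r' *m aop S = aop S *m rop N r' *m bop T'.
Proof.
move=> rK Kr sK Ks rTT.
have a1 : aop (1%:M : 'M['M[K]_N]_2) = 1%:M by apply: map_mx1.
have r1 : rop N (1%:M : 'M['M[K]_2]_2) = 1%:M.
  by rewrite /rop map_scalar_mx /= map_mx1.
apply: (@exchange_inv 'M['M['M[K]_N]_2]_2 (rop N r) (rop N r') (aop T)) rTT.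
- by rewrite -[RHS]r1 -rK ropM.
- by rewrite -[RHS]r1 -Kr ropM.
- by rewrite -[RHS]a1 -sK aopM.
by rewrite -[RHS]a1 -Ks aopM.
Qed.

(** Here and in the next three lemmas the suffix spells the order of the factors: r for [rop], a and
    b for [aop] and [bop]. The weights act as scalars on the chain, so they come out in front. *)
Lemma entry_rab r T T' k l k' l' :
  (rop N r *m aop T *m bop T') k l k' l'
  = \sum_m \sum_m' (r k m) k' m' *: (T m l *m T' m' l').
Proof.
rewrite mul_mx_scalarE [(_ *m aop _) k l]mxE mulr_suml summxE;
  apply: eq_bigr => m _.
rewrite [aop _ _ _]mxE [rop _ _ _ _]mxE -!mulmxE -mulmxA mxE;
  apply: eq_bigr => m' _.
by rewrite mul_scalar_mxE mxE -mul_scalar_mx.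
Qed.

Lemma entry_bar r T T' k l k' l' :
  (bop T' *m aop T *m rop N r) k l k' l'
  = \sum_m \sum_m' (r m l) m' l' *: (T' k' m' *m T k m).
Proof.
rewrite mxE summxE; apply: eq_bigr => m _.
rewrite mul_scalar_mxE [aop _ _ _]mxE [rop _ _ _ _]mxE -!mulmxE mxE.
by apply: eq_bigr => m' _; rewrite mul_mx_scalarE mxE -mul_mx_scalar.
Qed.

Lemma entry_bra r S T' k l k' l' :
  (bop T' *m rop N r *m aop S) k l k' l'
  = \sum_m \sum_m' (r k m) m' l' *: (T' k' m' *m S m l).
Proof.
rewrite mxE summxE; apply: eq_bigr => m _.
rewrite mul_scalar_mxE [aop _ _ _]mxE [rop _ _ _ _]mxE -!mulmxE.
rewrite mul_mx_scalarE mxE mulr_suml; apply: eq_bigr => m' _.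
by rewrite mxE -!mulmxE mul_mx_scalar -scalemxAl.
Qed.

Lemma entry_arb r S T' k l k' l' :
  (aop S *m rop N r *m bop T') k l k' l'
  = \sum_m \sum_m' (r m l) k' m' *: (S k m *m T' m' l').
Proof.
rewrite mul_mx_scalarE [(_ *m rop _ _) k l]mxE mulr_suml summxE;
  apply: eq_bigr => m _.
rewrite [aop _ _ _]mxE [rop _ _ _ _]mxE -!mulmxE -mulmxA mul_scalar_mxE mxE
  mulr_sumr; apply: eq_bigr => m' _.
by rewrite mxE -!mulmxE mul_scalar_mx scalemxAr.
Qed.

End RTT.

Section RTTMap.
Variables (K : fieldType) (N N' : nat) (f : {rmorphism 'M[K]_N -> 'M[K]_N'}).
Hypothesis f_scalar : forall c : K, f c%:M = c%:M.

Lemma map_aop T : map_mx (map_mx f) (aop T) = aop (map_mx f T).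
Proof. by apply/matrixP => k l; rewrite !mxE map_scalar_mx. Qed.

Lemma map_bop T : map_mx (map_mx f) (bop T) = bop (map_mx f T).
Proof. by rewrite /bop map_scalar_mx. Qed.

Lemma map_rop r : map_mx (map_mx f) (rop N r) = rop N' r.
Proof.
apply/matrixP => k l; rewrite !mxE; apply/matrixP => k' l'.
by rewrite !mxE f_scalar.
Qed.

(** Applied to [site_op j], which places a one-site relation at the site j, and to conjugation by
    the twist. Both fix the scalars, hence leave the weights [r] unchanged. *)
Lemma rtt_map r T T' : rtt r T T' -> rtt r (map_mx f T) (map_mx f T').
Proof.
move=> /(congr1 (map_mx (map_mx f))).
by rewrite !map_mxM /= !map_aop !map_bop !map_rop.
Qed.

Lemma rtt_map_inj r T T' :
  injective f -> rtt r (map_mx f T) (map_mx f T') -> rtt r T T'.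
Proof.
move=> f_inj; rewrite /rtt -!map_aop -!map_bop -!map_rop -!map_mxM /=.
by move/(map_mx_inj_of (map_mx_inj_of f_inj)).
Qed.

End RTTMap.

(** * Unitarity and Yang-Baxter as relations between 2 x 2 matrices *)

Section WeightRelations.
Variables (K : fieldType) (Lam : Type) (w : weights Lam K).

Lemma inord_lift n (i : nat) : (i <= n)%N ->
  inord i.+1 = lift ord0 (inord i : 'I_n.+1) :> 'I_n.+2.
Proof.
by move=> le_in; apply/val_inj; rewrite /= /bump /= !inordK.
Qed.

Lemma inord0 n : inord 0 = ord0 :> 'I_n.+1.
Proof. by apply/val_inj; rewrite /= inordK. Qed.

Lemma Lmx_unitary (uw : unitarity w) x y :
  Lmx w x y *m Lmx' w y x = 1%:M /\ Lmx' w y x *m Lmx w x y = 1%:M.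
Proof.
have := uw x y; rewrite inord_lift // !inord0 => e.
have e' := mulmx1C e.
move: e e' => /(congr1 (@hsplit K 1)) + /(congr1 (@hsplit K 1)).
rewrite !hsplit_multiplicative !(hsplit_Rop0, hsplit_Rop0') => e e'.
have inj := map_mx_inj_of (@site_op_inj K).
by split; apply: inj; rewrite map_mxM /= map_mx1.
Qed.

(* Splitting off the sites 1 and 2 turns the Yang-Baxter equation into the
   exchange relation of a chain reduced to the site 3. *)
Lemma rtt_Lmx (yb : yang_baxter w) x1 x2 x3 :
  rtt (Lmx w x1 x2) (Lmx w x1 x3) (Lmx w x2 x3).
Proof.
apply: (rtt_map_inj (f := @site_op K 'I_1 ord0)) (@site_op_inj K) _.
  exact: site_scalar.
have := yb x1 x2 x3; rewrite !inord_lift // !inord0.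
move=> /(congr1 (map_mx (@hsplit K 1) \o @hsplit K 2)) /=.
rewrite !hsplit_multiplicative !hsplit_Rop0 !hsplit_Rop_lift.
rewrite !map_mxM /= map_scalar_mx /= hsplit_Rop0.
have -> : map_mx (@hsplit K 1) (map_mx (site_op ord0) (Lmx w x1 x2)) =
    rop _ (Lmx w x1 x2).
  by apply/matrixP => k l; rewrite !mxE hsplit_site0.
have -> // : map_mx (@hsplit K 1) (map_mx (site_op (lift ord0 ord0)) (Lmx w x1
  x3)) =
    aop (map_mx (site_op ord0) (Lmx w x1 x3)).
by apply/matrixP => k l; rewrite !mxE hsplit_lift.
Qed.

End WeightRelations.

(** * Ordered products over sites and their inverses *)

Section Chains.
Variables (K : fieldType) (Lam : Type) (w : weights Lam K).
Variables (I : finType) (xi : I -> Lam).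

Definition chain (s : seq I) mu : 'M[opr K I]_2 :=
  \prod_(j <- s) map_mx (site_op j) (Lmx w mu (xi j)).

(** By unitarity $R_{aj}(\mu,\xi_j)^{-1}=R_{ja}(\xi_j,\mu)$, and inverting the product reverses the
    order of the sites. *)
Definition chain_inv (s : seq I) mu : 'M[opr K I]_2 :=
  \prod_(j <- rev s) map_mx (site_op j) (Lmx' w (xi j) mu).

Lemma chain_cons j s mu :
  chain (j :: s) mu = map_mx (site_op j) (Lmx w mu (xi j)) *m chain s mu.
Proof. by rewrite /chain big_cons. Qed.

Lemma chain_inv_cons j s mu :
  chain_inv (j :: s) mu
  = chain_inv s mu *m map_mx (site_op j) (Lmx' w (xi j) mu).
Proof. by rewrite /chain_inv rev_cons -cats1 big_cat /= big_seq1. Qed.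

Lemma chainK (uw : unitarity w) s mu :
  chain s mu *m chain_inv s mu = 1%:M /\ chain_inv s mu *m chain s mu = 1%:M.
Proof.
elim: s => [|j s [IH IH']];
  first by rewrite /chain /chain_inv /rev /= !big_nil; split; exact: mulmx1.
have [e e'] := Lmx_unitary uw mu (xi j).
move: e e' => /(congr1 (map_mx (@site_op K I j))) + /(congr1 (map_mx (@site_op
  K I j))).
rewrite !map_mxM /= !map_mx1 => e e'.
rewrite chain_cons chain_inv_cons; split.
  by rewrite -mulmxA [chain s mu *m _]mulmxA IH mul1mx.
by rewrite -mulmxA [map_mx _ _ *m (_ *m _)]mulmxA e' mul1mx.
Qed.

Lemma commuting_site_chain i s (A : 'M['M[K]_2]_2) nu : i \notin s ->
  commuting (map_mx (site_op i) A) (chain s nu)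
  /\ commuting (chain s nu) (map_mx (site_op i) A).
Proof.
elim: s => [|j s IH].
  by rewrite /chain big_nil /commuting; split; apply: commutingP => *;
     rewrite !mxE; case: (_ == _); rewrite ?mulmx0 ?mul0mx ?mulmx1 ?mul1mx.
rewrite inE negb_or => /andP[neq_ij /IH[c1 c2]]; rewrite chain_cons; split.
  apply: commutingMr c1; apply: commutingP => k l k' l'; rewrite !mxE.
  exact: site_comm.
apply: commutingMl c2; apply: commutingP => k l k' l'; rewrite !mxE.
by apply: site_comm; rewrite eq_sym.
Qed.

(** The train argument along the chain: [uniq] makes the factor of a site commute with those of all
    later sites, and a single site is covered by [rtt_Lmx]. *)
Lemma rtt_chain (yb : yang_baxter w) s mu nu : uniq s ->
  rtt (Lmx w mu nu) (chain s mu) (chain s nu).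
Proof.
elim: s => [|j s IH] /=.
  move=> _; rewrite /chain !big_nil /rtt.
  have -> : aop (1 : 'M[opr K I]_2) = 1%:M by apply: map_mx1.
  by rewrite !mulmx1 !mul1mx.
case/andP=> notin_js /IH rs; rewrite !chain_cons.
apply: rttM rs.
- by case: (commuting_site_chain (Lmx w mu (xi j)) nu notin_js).
- by case: (commuting_site_chain (Lmx w nu (xi j)) mu notin_js).
by apply: rtt_map => [c|]; [exact: site_scalar | exact: rtt_Lmx].
Qed.

End Chains.

(** * Components of the exchange relations *)

Section Components.
Variables (K : fieldType) (Lam : Type) (w : weights Lam K).

Lemma RwE x y k k' l l' :
  Rw w x y k k' l l' =
  (nth [::] [:: [:: 1; 0;        0;        0       ];
                [:: 0; bp w x y; cp w x y; 0       ];
                [:: 0; cm w x y; bm w x y; 0       ];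
                [:: 0; 0;        0;        am w x y]] (2 * k + k')%N)`_(2 * l +
                  l')%N.
Proof.
have bound (i j : 'I_2) : (2 * i + j < 4)%N.
  by case: i j => [[|[|i]] Hi] [[|[|j]] Hj].
by rewrite /Rw mxE !inordK.
Qed.

(** Collected as one rewriting rule: the ten zeros of the six-vertex pattern cut each double sum
    below down to a few terms. *)
Lemma Rw_val x y :
  (((Rw w x y 0 0 0 0 = 1)
     * (Rw w x y 0 0 0 1 = 0)
     * (Rw w x y 0 0 1 0 = 0)
     * (Rw w x y 0 0 1 1 = 0))
    * ((Rw w x y 0 1 0 0 = 0)
     * (Rw w x y 0 1 0 1 = bp w x y)
     * (Rw w x y 0 1 1 0 = cp w x y)
     * (Rw w x y 0 1 1 1 = 0))
    * ((Rw w x y 1 0 0 0 = 0)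
     * (Rw w x y 1 0 0 1 = cm w x y)
     * (Rw w x y 1 0 1 0 = bm w x y)
     * (Rw w x y 1 0 1 1 = 0))
    * ((Rw w x y 1 1 0 0 = 0)
     * (Rw w x y 1 1 0 1 = 0)
     * (Rw w x y 1 1 1 0 = 0)
     * (Rw w x y 1 1 1 1 = am w x y)))%type.
Proof. by do ![split]; rewrite RwE. Qed.

Lemma LmxE x y k l s t : Lmx w x y k l s t = Rw w x y k s l t.
Proof. by rewrite !mxE. Qed.

Lemma Lmx'E x y k l s t : Lmx' w x y k l s t = Rw w x y s k t l.
Proof. by rewrite !mxE. Qed.

Lemma sum2 (V : nmodType) (F : 'I_2 -> V) : \sum_m F m = F 0 + F 1.
Proof. by rewrite big_ord_recl big_ord1; congr (_ + F _); apply: val_inj. Qed.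

Section Relations.
Variables (N : nat) (x y : Lam) (T T' : 'M['M[K]_N]_2).
Hypothesis rT : rtt (Lmx w x y) T T'.

Lemma rtt_entries k l k' l' :
  \sum_m \sum_m' Rw w x y k k' m m' *: (T m l *m T' m' l')
  = \sum_m \sum_m' Rw w x y m m' l l' *: (T' k' m' *m T k m).
Proof.
transitivity ((rop N (Lmx w x y) *m aop T *m bop T') k l k' l').
  by rewrite entry_rab; do 2!apply: eq_bigr => ? _; rewrite LmxE.
by rewrite rT entry_bar; do 2!apply: eq_bigr => ? _; rewrite LmxE.
Qed.

Lemma rtt_DC :
  am w x y *: (T 1 1 *m T' 1 0)
  = cp w x y *: (T' 1 1 *m T 1 0) + bm w x y *: (T' 1 0 *m T 1 1).
Proof.
by have := rtt_entries 1 1 1 0; rewrite !sum2 !Rw_val !scale0r !(addr0, add0r).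
Qed.

Lemma rtt_CC : am w x y *: (T 1 0 *m T' 1 0) = T' 1 0 *m T 1 0.
Proof.
have := rtt_entries 1 0 1 0.
by rewrite !sum2 !Rw_val !scale0r !(addr0, add0r) scale1r.
Qed.

Lemma rtt_CD :
  am w x y *: (T 1 0 *m T' 1 1)
  = bp w x y *: (T' 1 1 *m T 1 0) + cm w x y *: (T' 1 0 *m T 1 1).
Proof.
by have := rtt_entries 1 0 1 1; rewrite !sum2 !Rw_val !scale0r !(addr0, add0r).
Qed.

Lemma rtt_BC :
  bp w x y *: (T 0 1 *m T' 1 0) + cp w x y *: (T 1 1 *m T' 0 0)
  = cp w x y *: (T' 1 1 *m T 0 0) + bm w x y *: (T' 1 0 *m T 0 1).
Proof.
by have := rtt_entries 0 1 1 0; rewrite !sum2 !Rw_val !scale0r !(addr0, add0r).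
Qed.

Lemma rtt_BD :
  bp w x y *: (T 0 1 *m T' 1 1) + cp w x y *: (T 1 1 *m T' 0 1)
  = am w x y *: (T' 1 1 *m T 0 1).
Proof.
by have := rtt_entries 0 1 1 1; rewrite !sum2 !Rw_val !scale0r !(addr0, add0r).
Qed.

(** The exchange relation solved for the inverse matrix [S]. Since $R_{12}(x,y)^{-1}=R_{21}(y,x)$,
    the weights appear with exchanged arguments. *)
Lemma rtt_inv_AC (uw : unitarity w) S :
    S *m T = 1%:M -> T *m S = 1%:M ->
  T' 1 0 *m S 0 0 + cm w y x *: (T' 1 1 *m S 1 0)
  = bm w y x *: (S 0 0 *m T' 1 0).
Proof.
move=> ST TS; have [rK Kr] := Lmx_unitary uw x y.
have := congr1 (fun M : 'M['M['M[K]_N]_2]_2 => M 0 0 1 0) (rtt_inv rK Kr ST TS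
  rT).
rewrite entry_bra entry_arb !sum2 !Lmx'E !Rw_val !scale0r !(addr0, add0r).
by rewrite scale1r.
Qed.

End Relations.

Lemma entry_LmxM x y k l s t :
  (Lmx w x y *m Lmx' w y x) k l s t
  = \sum_m \sum_u Rw w x y k s m u * Rw w y x u m t l.
Proof.
rewrite mxE summxE; apply: eq_bigr => m _; rewrite mxE; apply: eq_bigr => u _.
by rewrite LmxE Lmx'E.
Qed.

Lemma am_unit (uw : unitarity w) x y : am w x y * am w y x = 1.
Proof.
have [e _] := Lmx_unitary uw x y.
have := entry_LmxM x y 1 1 1 1; rewrite e !sum2 !Rw_val !mxE.
by rewrite !mul0r !add0r => <-.
Qed.

Lemma cm_bm_unit (uw : unitarity w) x y :
  cm w x y * bm w y x + bm w x y * cp w y x = 0.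
Proof.
have [e _] := Lmx_unitary uw x y.
have := entry_LmxM x y 1 0 0 1; rewrite e !sum2 !Rw_val !mxE.
by rewrite !mul0r addr0 add0r => <-.
Qed.

(** The Yang-Baxter equation is the exchange relation of a one-site chain. This is the entry (0,0)
    at that site of the component with indices (1,0) in the first and (0,1) in the second auxiliary
    space. *)
Lemma cm_bm_yb (yb : yang_baxter w) x y z :
  cm w x y * bm w y z + bm w x y * (cm w x z * cp w y z) = bm w x z * cm w x y.
Proof.
have entryE a b (A B C D : 'M[K]_2) : (a *: (A *m B) + b *: (C *m D)) 0 0 =
    a * (A 0 0 * B 0 0 + A 0 1 * B 1 0) + b * (C 0 0 * D 0 0 + C 0 1 * D 1 0).
  by rewrite !mxE !sum2.
have := rtt_entries (rtt_Lmx yb x y z) 1 0 0 1.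
rewrite !sum2 !Rw_val !scale0r !(addr0, add0r) => /matrixP/(_ 0 0).
rewrite !entryE !LmxE !Rw_val !(mul0r, mul1r, mulr1, mulr0, addr0, add0r) => ->.
exact: mulrC.
Qed.
End Components.

(** * Recursion on the number of sites *)

Section Recursion.
Variables (K : fieldType) (Lam : Type) (w : weights Lam K).

Definition tmx n (xi : 'I_n -> Lam) mu := chain w xi (rev (enum 'I_n)) mu.
Definition tmx_inv n (xi : 'I_n -> Lam) mu := chain_inv w xi (rev (enum 'I_n))
  mu.

Lemma rev_enum_ordS n :
  rev (enum 'I_n.+1) = rcons (map (lift ord0) (rev (enum 'I_n))) ord0.
Proof. by rewrite enum_ordSl rev_cons map_rev. Qed.

Lemma aux_block_monodromy n (xi : 'I_n -> Lam) mu k l :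
  aux_block (monodromy w xi mu) k l = tmx xi mu k l.
Proof.
transitivity (toblk id (monodromy w xi mu) k l); first by rewrite mxE.
congr (fun_of_matrix _ k l); rewrite /monodromy /tmx /chain.
have idK : cancel (@id (option 'I_n)) id by [].
elim: (rev _) => [|j s IH]; first by rewrite !big_nil; apply: toblk1 idK.
rewrite !big_cons -IH -(toblk_RopN idK idK).
exact: (toblk_mul idK idK).
Qed.

(** The first site acts as a second auxiliary space b: its factor $R_{a1}$, rightmost in the
    monodromy matrix, has scalar coefficients on the remaining sites, while the other factors ignore
    b. *)
Lemma map_hsplit_tmx n (xi : 'I_n.+1 -> Lam) mu :
  map_mx (@hsplit K n) (tmx xi mu)
  = aop (tmx (xi \o lift ord0) mu) *m rop _ (Lmx w mu (xi ord0)).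
Proof.
rewrite /tmx rev_enum_ordS /chain -cats1 big_cat big_map /= big_seq1.
rewrite map_mxM /=; congr (_ *m _); last first.
  by apply/matrixP => k l; rewrite !mxE hsplit_site0.
elim: (rev _) => [|j s IH]; first by rewrite !big_nil /aop !map_mx1.
rewrite !big_cons aopM map_mxM /= IH; congr (_ *m _).
by apply/matrixP => k l; rewrite !mxE hsplit_lift.
Qed.

Lemma map_hsplit_tmx_inv n (xi : 'I_n.+1 -> Lam) mu :
  map_mx (@hsplit K n) (tmx_inv xi mu)
  = rop _ (Lmx' w (xi ord0) mu) *m aop (tmx_inv (xi \o lift ord0) mu).
Proof.
rewrite /tmx_inv rev_enum_ordS /chain_inv rev_rcons big_cons map_mxM /=.
congr (_ *m _).
  by apply/matrixP => k l; rewrite !mxE hsplit_site0.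
rewrite -map_rev big_map.
elim: (rev (rev _)) => [|j s IH]; first by rewrite !big_nil /aop !map_mx1.
rewrite !big_cons aopM map_mxM /= IH; congr (_ *m _).
by apply/matrixP => k l; rewrite !mxE hsplit_lift.
Qed.

(* In Ftwist the last factor, which is 1, is left out. *)
Definition Fall n (xi : 'I_n -> Lam) : opr K 'I_n :=
  \prod_(i <- rev (enum 'I_n)) Fpart w xi i.

Lemma e11_e22 : e11 K + e22 K = 1%:M.
Proof.
apply/matrixP => -[[|[|k]] Hk] -[[|[|l]] Hl] //; rewrite !mxE /=;
by rewrite ?addr0 ?add0r.
Qed.

Lemma Ftwist_Fall n (xi : 'I_n -> Lam) : Ftwist w xi = Fall xi.
Proof.
rewrite /Ftwist big_mkcond; apply: eq_bigr => i _.
case: ltnP => // le_ni; rewrite /Fpart /Rtail big_pred0 => [|j].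
  by rewrite [_ *m _]mulmx1 -raddfD /= e11_e22 site1.
by apply/negbTE; rewrite -leqNgt -ltnS (leq_trans _ le_ni).
Qed.

Lemma hsplit_Fpart_lift n (xi : 'I_n.+1 -> Lam) i :
  hsplit (Fpart w xi (lift ord0 i)) = (Fpart w (xi \o lift ord0) i)%:M.
Proof.
have hR : hsplit (Rtail w xi (lift ord0 i)) = (Rtail w (xi \o lift ord0) i)%:M.
  rewrite /Rtail rev_enum_ordS -cats1 big_cat big_map /= big_cons big_nil /=.
  rewrite mulr1; elim: (rev _) => [|j s IH].
    by rewrite !big_nil; rewrite hsplit_multiplicative.
  rewrite !big_cons /bump /= !add1n ltnS; case: ifP => // _.
  rewrite hsplit_multiplicative IH hsplit_Rop_lift.
  by rewrite [RHS]scalar_mxM.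
rewrite /Fpart raddfD /= hsplit_multiplicative hR !hsplit_lift.
by rewrite [RHS]raddfD /= scalar_mxM.
Qed.

(** $R_{1,2\dots L}$ is the monodromy matrix of the remaining sites at $\xi_1$, with $V_1$ as
    auxiliary space; [e11] keeps the upper row of the identity and [e22] the lower row of this
    matrix. *)
Lemma hsplit_Fpart0 n (xi : 'I_n.+1 -> Lam) (P := hsplit (Fpart w xi ord0)) :
  [/\ P 0 0 = 1%:M, P 0 1 = 0
    & forall l, P 1 l = tmx (xi \o lift ord0) (xi ord0) 1 l].
Proof.
have hR : hsplit (Rtail w xi ord0) = tmx (xi \o lift ord0) (xi ord0).
  rewrite /Rtail rev_enum_ordS -cats1 big_cat big_map /= big_cons big_nil /=.
  rewrite mulr1 /tmx /chain; elim: (rev _) => [|j s IH].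
    by rewrite !big_nil; rewrite hsplit_multiplicative.
  rewrite !big_cons /= hsplit_multiplicative IH.
  by rewrite hsplit_Rop0.
have PE k l : P k l = (e11 K k l)%:M
    + \sum_m (e22 K k m)%:M *m tmx (xi \o lift ord0) (xi ord0) m l.
  rewrite /P /Fpart raddfD /= hsplit_multiplicative hR !hsplit_site0.
  rewrite mxE [X in X + _]mxE [X in _ + X]mxE; congr (_ + _).
  by apply: eq_bigr => m _; rewrite mxE.
split=> [||l]; rewrite PE sum2 !mxE /= !mul_scalar_mx scale0r.
- by rewrite scale0r !addr0.
- by rewrite scale0r !addr0 raddf0.
- by rewrite raddf0 scale1r !add0r.
Qed.

Lemma hsplit_tmx n (xi : 'I_n.+1 -> Lam) mu k l p q :
  hsplit (tmx xi mu k l) p q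
  = \sum_m Rw w mu (xi ord0) m p l q *: tmx (xi \o lift ord0) mu k m.
Proof.
transitivity (map_mx (@hsplit K n) (tmx xi mu) k l p q);
  first by rewrite [in RHS]mxE.
rewrite map_hsplit_tmx mxE summxE; apply: eq_bigr => m _.
by rewrite [aop _ _ _]mxE mul_scalar_mxE [rop _ _ _ _]mxE mxE LmxE -mulmxE
  mul_mx_scalar.
Qed.

Lemma hsplit_tmx_inv n (xi : 'I_n.+1 -> Lam) mu k l p q :
  hsplit (tmx_inv xi mu k l) p q
  = \sum_m Rw w (xi ord0) mu p k q m *: tmx_inv (xi \o lift ord0) mu m l.
Proof.
transitivity (map_mx (@hsplit K n) (tmx_inv xi mu) k l p q);
  first by rewrite [in RHS]mxE.
rewrite map_hsplit_tmx_inv mxE summxE; apply: eq_bigr => m _.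
by rewrite [aop _ _ _]mxE mul_mx_scalarE [rop _ _ _ _]mxE mxE Lmx'E -mulmxE
  mul_scalar_mx.
Qed.

Lemma hsplit_Fall n (xi : 'I_n.+1 -> Lam) :
  hsplit (Fall xi) = (Fall (xi \o lift ord0))%:M *m hsplit (Fpart w xi ord0).
Proof.
rewrite /Fall rev_enum_ordS -cats1 big_cat big_map /= big_seq1.
rewrite hsplit_multiplicative; congr (_ *m _).
elim: (rev _) => [|j s IH].
  by rewrite !big_nil; rewrite hsplit_multiplicative.
rewrite !big_cons hsplit_multiplicative IH hsplit_Fpart_lift.
by rewrite [RHS]scalar_mxM.
Qed.

End Recursion.

(** * The twisted operators *)

Section SiteMatrices.
Variable K : fieldType.

Lemma ord2P (P : 'I_2 -> Prop) : P 0 -> P 1 -> forall i, P i.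
Proof.
by move=> P0 P1 [[|[|i]] Hi] //; [move: P0 | move: P1]; congr P; apply: val_inj.
Qed.

Lemma diag2E (p q : K) : (diag2 p q 0 0 = p) * (diag2 p q 0 1 = 0)
  * (diag2 p q 1 0 = 0) * (diag2 p q 1 1 = q).
Proof. by rewrite !mxE. Qed.

Lemma matrix2P (A : Type) (M N : 'M[A]_2) :
  M 0 0 = N 0 0 -> M 0 1 = N 0 1 -> M 1 0 = N 1 0 -> M 1 1 = N 1 1 -> M = N.
Proof. by move=> *; apply/matrixP; do 2![apply: ord2P]. Qed.

Lemma mul2E (A : pzRingType) (M N : 'M[A]_2) k l :
  (M *m N) k l = M k 0 * N 0 l + M k 1 * N 1 l.
Proof. by rewrite mxE sum2. Qed.

Lemma diag2M (p q r s : K) : diag2 p q *m diag2 r s = diag2 (p * r) (q * s).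
Proof.
by apply: matrix2P; rewrite mul2E !diag2E ?mul0r ?mulr0 ?addr0 ?add0r.
Qed.

Lemma diag2_1 : diag2 1 1 = 1%:M :> 'M[K]_2.
Proof. by apply: matrix2P; rewrite !mxE. Qed.

Lemma diag2_e12 (p q : K) : diag2 p q *m e12 K = p *: e12 K.
Proof.
by apply: matrix2P; rewrite mul2E !diag2E !mxE /= ?mul0r ?mulr0 ?addr0 ?add0r.
Qed.

Lemma e21_diag2 (p q : K) : e21 K *m diag2 p q = p *: e21 K.
Proof.
by apply: matrix2P; rewrite mul2E !diag2E !mxE /= ?mul0r ?mulr0 ?addr0 ?add0r
  ?mulr1 ?mul1r.
Qed.

Lemma diag2_e21 (p q : K) : diag2 p q *m e21 K = q *: e21 K.
Proof.
by apply: matrix2P; rewrite mul2E !diag2E !mxE /= ?mul0r ?mulr0 ?addr0 ?add0r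
  ?mulr1 ?mul1r.
Qed.

Lemma tensor_scale (I : finType) (l : I) a (M N : I -> 'M[K]_2) :
  (forall i, i != l -> M i = N i) -> M l = a *: N l ->
  tensor_op M = a *: tensor_op N.
Proof.
move=> eqMN eql; apply: entry_inj => s t; rewrite entry_tensor.
rewrite [RHS]mxE -/(entry _ _ _) entry_tensor (bigD1 l) //= [in RHS](bigD1 l)
  //=.
rewrite eql mxE -mulrA; congr (_ * (_ * _)).
by apply: eq_bigr => i /eqMN ->.
Qed.

Lemma tensor_diag_mul (I : finType) (p q r s : I -> K) :
  tensor_op (fun i => diag2 (p i) (q i))
    *m tensor_op (fun i => diag2 (r i) (s i))
  = tensor_op (fun i => diag2 (p i * r i) (q i * s i)).
Proof. by rewrite tensor_mul; apply: eq_tensor => i; rewrite diag2M. Qed.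

Lemma tensor_diag_inv (I : finType) (p q r s : I -> K) :
    (forall i, p i * r i = 1) -> (forall i, q i * s i = 1) ->
  tensor_op (fun i => diag2 (p i) (q i))
    *m tensor_op (fun i => diag2 (r i) (s i))
  = 1%:M.
Proof.
move=> pr qs; rewrite tensor_diag_mul -tensor1; apply: eq_tensor => i.
by rewrite pr qs diag2_1.
Qed.
End SiteMatrices.

(** * Blocks of the claimed right-hand sides over the first site *)

Section Twisted.
Variables (K : fieldType) (Lam : Type) (w : weights Lam K).
Hypotheses (uw : unitarity w) (yb : yang_baxter w).

Definition Dt n (xi : 'I_n -> Lam) mu : opr K 'I_n :=
  tensor_op (fun i => diag2 (bm w mu (xi i)) (am w mu (xi i))).

(* The twisted entry (1,1) of the inverse monodromy matrix. *)
Definition Et n (xi : 'I_n -> Lam) mu : opr K 'I_n :=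
  tensor_op (fun i => diag2 1 (bm w (xi i) mu)).

Definition Cterm n (xi : 'I_n -> Lam) mu (l : 'I_n) : opr K 'I_n :=
  tensor_op (fun i : 'I_n =>
    if (i < l)%N then
      diag2 (bm w mu (xi i) / bm w (xi l) (xi i)) (am w mu (xi i))
    else if i == l then e12 K
    else
      diag2 (bm w mu (xi i) / bm w (xi l) (xi i))
            (am w mu (xi i) / am w (xi l) (xi i))).

Definition Ct n (xi : 'I_n -> Lam) mu : opr K 'I_n :=
  \sum_(l < n) cm w mu (xi l) *: Cterm xi mu l.

Definition Bterm n (xi : 'I_n -> Lam) mu (l : 'I_n) : opr K 'I_n :=
  tensor_op (fun i : 'I_n =>
    if (i < l)%N then
      diag2 (bm w mu (xi i))
            (am w mu (xi i) * am w (xi i) (xi l) / bm w (xi i) (xi l))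
    else if i == l then e21 K
    else
      diag2 (bm w mu (xi i)) (am w mu (xi i) / bm w (xi i) (xi l))).

Definition Bt n (xi : 'I_n -> Lam) mu : opr K 'I_n :=
  \sum_(l < n) cp w mu (xi l) *: Bterm xi mu l.

Lemma am_neq0 x y : am w x y != 0.
Proof.
apply/eqP => a0; have := am_unit uw x y; rewrite a0 mul0r => /eqP.
by rewrite eq_sym oner_eq0.
Qed.

Lemma Dt_unit n (xi : 'I_n -> Lam) mu :
  (forall i, bm w mu (xi i) != 0) -> Dt xi mu \in unitmx.
Proof.
move=> nz; apply: (proj1 (mulmx1_unit (tensor_diag_inv
  (r := fun i => (bm w mu (xi i))^-1)
  (s := fun i => (am w mu (xi i))^-1) _ _))).
  by move=> i; rewrite divff.
by move=> i; rewrite divff ?am_neq0.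
Qed.

Lemma Dt_comm n (xi : 'I_n -> Lam) x y : Dt xi x *m Dt xi y = Dt xi y *m Dt xi
  x.
Proof. by rewrite !tensor_diag_mul; apply: eq_tensor => i; congr diag2;
  apply: mulrC. Qed.

Lemma Dt_Et_comm n (xi : 'I_n -> Lam) x y : Dt xi x *m Et xi y = Et xi y *m Dt
  xi x.
Proof. by rewrite !tensor_diag_mul; apply: eq_tensor => i; congr diag2;
  apply: mulrC. Qed.

Section Step.
Variables (n : nat) (xi : 'I_n.+1 -> Lam) (mu : Lam).
Let xi' := xi \o lift ord0.
Let nu := xi ord0.
Hypothesis bm_neq0 : forall i j : 'I_n.+1, i != j -> bm w (xi i) (xi j) != 0.

Lemma bm_0S (i : 'I_n) : bm w nu (xi' i) != 0.
Proof. by apply: bm_neq0; rewrite neq_lift. Qed.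

Lemma bm_S0 (i : 'I_n) : bm w (xi' i) nu != 0.
Proof. by apply: bm_neq0; rewrite eq_sym neq_lift. Qed.

Lemma hsplit_Dt (X := hsplit (Dt xi mu)) :
  [/\ X 0 0 = bm w mu nu *: Dt xi' mu, X 0 1 = 0, X 1 0 = 0
    & X 1 1 = am w mu nu *: Dt xi' mu].
Proof. by rewrite /X !hsplit_tensor !diag2E !scale0r. Qed.

Lemma hsplit_Et (X := hsplit (Et xi mu)) :
  [/\ X 0 0 = Et xi' mu, X 0 1 = 0, X 1 0 = 0
    & X 1 1 = bm w nu mu *: Et xi' mu].
Proof. by rewrite /X !hsplit_tensor !diag2E !scale0r scale1r. Qed.

(* D(mu) D(xi_1)^-1 on the last n sites, twisted; see CG_Dt. *)
Definition CG : opr K 'I_n :=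
  tensor_op (fun i => diag2 (bm w mu (xi' i) / bm w nu (xi' i))
                            (am w mu (xi' i) / am w nu (xi' i))).

(** The diagonal block of [Ct] over $e_1$: the term l carries the upper entry of its diagonal factor
    at the first site. *)
Definition CX : opr K 'I_n :=
  \sum_(l < n) (bm w mu nu / bm w (xi' l) nu * cm w mu (xi' l))
    *: Cterm xi' mu l.

Lemma hsplit_Cterm0 k l : hsplit (Cterm xi mu ord0) k l = e12 K k l *: CG.
Proof. by rewrite hsplit_tensor; congr (_ *: _); apply: eq_tensor. Qed.

Lemma hsplit_CtermS j k l : hsplit (Cterm xi mu (lift ord0 j)) k l
  = diag2 (bm w mu nu / bm w (xi' j) nu) (am w mu nu) k l *: Cterm xi' mu j.
Proof.
rewrite hsplit_tensor; congr (_ *: _); apply: eq_tensor => i.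
Qed.

Lemma hsplit_Ct (X := hsplit (Ct xi mu)) :
  [/\ X 0 0 = CX, X 0 1 = cm w mu nu *: CG, X 1 0 = 0
    & X 1 1 = am w mu nu *: Ct xi' mu].
Proof.
have XE k l : X k l = (cm w mu nu * e12 K k l) *: CG
    + \sum_(j < n) (cm w mu (xi' j) * diag2 (bm w mu nu / bm w (xi' j) nu) (am
      w mu nu) k l)
                    *: Cterm xi' mu j.
  rewrite /X /Ct big_ord_recl raddfD raddf_sum mxE summxE; congr (_ + _).
    by rewrite hsplitZ hsplit_Cterm0 scalerA.
  by apply: eq_bigr => j _; rewrite hsplitZ hsplit_CtermS scalerA.
split; rewrite XE.
- rewrite mxE mulr0 scale0r add0r; apply: eq_bigr => j _.
  by rewrite diag2E mulrC.
- rewrite mxE mulr1 big1 ?addr0 // => j _.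
  by rewrite diag2E mulr0 scale0r.
- rewrite mxE mulr0 scale0r add0r big1 // => j _.
  by rewrite diag2E mulr0 scale0r.
rewrite mxE mulr0 scale0r add0r scaler_sumr; apply: eq_bigr => j _.
by rewrite diag2E mulrC scalerA.
Qed.

Lemma CG_Dt : CG *m Dt xi' nu = Dt xi' mu.
Proof.
rewrite tensor_diag_mul; apply: eq_tensor => i.
by rewrite !divfK ?bm_0S ?am_neq0.
Qed.

(** Off l, the quotients in [CG] exchange $\xi_1$ for $\mu$ in the numerators. At l, [e12] has only
    its first row, so the upper entry of [CG] survives as a scalar. *)
Lemma CG_Cterm l :
  CG *m Cterm xi' nu l = (bm w mu (xi' l) / bm w nu (xi' l)) *: Cterm xi' mu l.
Proof.
rewrite tensor_mul; apply: (tensor_scale (l := l)) => [i neq_il|].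
  rewrite (negbTE neq_il); case: ifP => _; rewrite diag2M; congr diag2.
  - by rewrite mulrA divfK ?bm_0S.
  - by rewrite divfK ?am_neq0.
  - by rewrite mulrA divfK ?bm_0S.
  by rewrite mulrA divfK ?am_neq0.
by rewrite ltnn eqxx diag2_e12.
Qed.

(* Term by term, this is a three-term identity between the weights. *)
Lemma Ct_split : Ct xi' mu = CX + cm w mu nu *: (CG *m Ct xi' nu).
Proof.
rewrite /Ct mulmx_sumr scaler_sumr -big_split; apply: eq_bigr => l _ /=.
rewrite -scalemxAr CG_Cterm !scalerA -scalerDl; congr (_ *: _).
have e1 := cm_bm_yb yb mu (xi' l) nu.
have e2 := cm_bm_unit uw nu (xi' l).
have nz1 := bm_0S l; have nz2 := bm_S0 l.
apply: (mulIf nz2); apply: (mulIf nz1).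
transitivity (bm w mu nu * cm w mu (xi' l) * bm w nu (xi' l)
   + cm w mu nu * bm w mu (xi' l) * (cm w nu (xi' l) * bm w (xi' l) nu));
     last first.
  by field; rewrite nz1 nz2.
(* Unitarity trades $c_-(\xi_1,\xi_l)b_-(\xi_l,\xi_1)$ for $-b_-(\xi_1,\xi_l)c_+(\xi_l,\xi_1)$,
   after which $b_-(\xi_1,\xi_l)$ is a common factor and the Yang-Baxter component [e1]
   concludes. *)
rewrite -e1 -[cm w nu (xi' l) * _](addrK (bm w nu (xi' l) * cp w (xi' l) nu))
  e2.
by ring.
Qed.

(** The tail of the first term of [Bt]. It is also $\tilde D'(\mu)$ times the tensor product in the
    formula for $\tilde A'(\xi_1)$, which is how it arises in the induction step for B. *)
Definition BG : opr K 'I_n :=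
  tensor_op (fun i => diag2 (bm w mu (xi' i))
                            (am w mu (xi' i) / bm w (xi' i) nu)).

(* The conjugate of Bt by D(xi_1), see Dt_Bt. *)
Definition BY : opr K 'I_n :=
  \sum_(l < n) (am w nu (xi' l) / bm w nu (xi' l) * cp w mu (xi' l)) *: Bterm
    xi' mu l.

Lemma hsplit_Bterm0 k l : hsplit (Bterm xi mu ord0) k l = e21 K k l *: BG.
Proof. by rewrite hsplit_tensor; congr (_ *: _); apply: eq_tensor. Qed.

Lemma hsplit_BtermS j k l : hsplit (Bterm xi mu (lift ord0 j)) k l
  = diag2 (bm w mu nu) (am w mu nu * am w nu (xi' j) / bm w nu (xi' j)) k l
    *: Bterm xi' mu j.
Proof.
by rewrite hsplit_tensor; congr (_ *: _); apply: eq_tensor => i.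
Qed.

Lemma hsplit_Bt (X := hsplit (Bt xi mu)) :
  [/\ X 0 0 = bm w mu nu *: Bt xi' mu, X 0 1 = 0, X 1 0 = cp w mu nu *: BG
    & X 1 1 = am w mu nu *: BY].
Proof.
have XE k l : X k l = (cp w mu nu * e21 K k l) *: BG
    + \sum_(j < n) (cp w mu (xi' j) * diag2 (bm w mu nu)
        (am w mu nu * am w nu (xi' j) / bm w nu (xi' j)) k l) *: Bterm xi' mu j.
  rewrite /X /Bt big_ord_recl raddfD raddf_sum mxE summxE; congr (_ + _).
    by rewrite hsplitZ hsplit_Bterm0 scalerA.
  by apply: eq_bigr => j _; rewrite hsplitZ hsplit_BtermS scalerA.
split; rewrite XE.
- rewrite mxE mulr0 scale0r add0r scaler_sumr; apply: eq_bigr => j _.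
  by rewrite diag2E mulrC scalerA.
- rewrite mxE mulr0 scale0r add0r big1 // => j _.
  by rewrite diag2E mulr0 scale0r.
- rewrite mxE mulr1 big1 ?addr0 // => j _.
  by rewrite diag2E mulr0 scale0r.
rewrite mxE mulr0 scale0r add0r scaler_sumr; apply: eq_bigr => j _.
by rewrite diag2E scalerA; congr (_ *: _); ring.
Qed.

(** Diagonal factors commute off l. At l, [e21] picks the lower entry of [Dt] on its left and the
    upper entry on its right, whence the ratio $a_-/b_-$. *)
Lemma Dt_Bterm l : Dt xi' nu *m Bterm xi' mu l
  = (am w nu (xi' l) / bm w nu (xi' l)) *: (Bterm xi' mu l *m Dt xi' nu).
Proof.
rewrite !tensor_mul; apply: (tensor_scale (l := l)) => [i neq_il|].
  by rewrite (negbTE neq_il); case: ifP => _; rewrite !diag2M; congr diag2;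
    apply: mulrC.
rewrite ltnn eqxx diag2_e21 e21_diag2 scalerA divfK //; exact: bm_0S.
Qed.

Lemma Dt_Bt : Dt xi' nu *m Bt xi' mu = BY *m Dt xi' nu.
Proof.
rewrite mulmx_sumr mulmx_suml; apply: eq_bigr => l _.
by rewrite -scalemxAr -scalemxAl Dt_Bterm scalerA mulrC.
Qed.

End Step.
End Twisted.

(** * Conjugation by an invertible matrix as a ring morphism *)

Section Conjugation.
Variables (K : fieldType) (N : nat) (F : 'M[K]_N).
Hypothesis uF : F \in unitmx.

(** The proof of invertibility is an argument so that the ring morphism structure can be attached to
    [conjmx_by uF]. *)
Definition conjmx_by of F \in unitmx := fun X : 'M[K]_N => F *m X *m invmx F.
Notation c := (conjmx_by uF).

Lemma conjmx_by_nmod : nmod_morphism c.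
Proof.
split; first by rewrite /c mulmx0 mul0mx.
by move=> X Y; rewrite /c mulmxDr mulmxDl.
Qed.

Lemma conjmx_by_monoid : monoid_morphism c.
Proof.
split; first by rewrite /c mulmx1 mulmxV.
by move=> X Y; rewrite /c -!mulmxE !mulmxA mulmxKV.
Qed.

HB.instance Definition _ :=
  GRing.isNmodMorphism.Build 'M[K]_N 'M[K]_N c conjmx_by_nmod.
HB.instance Definition _ :=
  GRing.isMonoidMorphism.Build 'M[K]_N 'M[K]_N c conjmx_by_monoid.

Lemma conjmx_by_scalar a : c a%:M = a%:M.
Proof. by rewrite /c mul_mx_scalar -scalemxAl mulmxV // scalemx1. Qed.

Lemma conjmx_byZ a X : c (a *: X) = a *: c X.
Proof. by rewrite /c -scalemxAr -scalemxAl. Qed.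

Lemma conjmx_byE X : F *m X = c X *m F.
Proof. by rewrite /c mulmxKV. Qed.
End Conjugation.

(** * Induction on the number of sites *)

Section Twist.
Variables (K : fieldType) (Lam : Type) (w : weights Lam K).
Hypotheses (uw : unitarity w) (yb : yang_baxter w).

(** The induction hypothesis, stated for all [mu] because the step uses both $\mu$ and $\xi_1$. The
    inverse monodromy entry stands in for A, whose formula requires further nonvanishing conditions
    on $\mu$. *)
Definition diagonalizes n (xi : 'I_n -> Lam) (F : opr K 'I_n) := forall mu,
  [/\ F *m tmx w xi mu 1 1 *m invmx F = Dt w xi mu,
      F *m tmx w xi mu 1 0 *m invmx F = Ct w xi mu,
      F *m tmx w xi mu 0 1 *m invmx F = Bt w xi mu
    & F *m tmx_inv w xi mu 0 0 *m invmx F = Et w xi mu].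

Lemma rtt_tmx n (xi : 'I_n -> Lam) x y :
  rtt (Lmx w x y) (tmx w xi x) (tmx w xi y).
Proof. by apply: rtt_chain; rewrite ?rev_uniq ?enum_uniq. Qed.

Lemma twisted_A n (xi : 'I_n -> Lam) (F : opr K 'I_n) mu :
    F \in unitmx -> diagonalizes xi F ->
    (forall i, bm w mu (xi i) != 0) -> (forall i, bm w (xi i) mu != 0) ->
  F *m tmx w xi mu 0 0 *m invmx F
  = tensor_op (fun i => diag2 1 (1 / bm w (xi i) mu))
    + Bt w xi mu *m invmx (Dt w xi mu) *m Ct w xi mu.
Proof.
move=> uF /(_ mu)[eD eC eB eE] nz nz'.
pose f := conjmx_by uF; pose t := map_mx f (tmx w xi mu).
pose s := map_mx f (tmx_inv w xi mu).
have st : s *m t = 1%:M.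
  rewrite -map_mxM /=; have [_ ->] := chainK xi uw (rev (enum 'I_n)) mu.
  by rewrite map_mx1.
have tD : t 1 1 = Dt w xi mu by rewrite mxE.
have tC : t 1 0 = Ct w xi mu by rewrite mxE.
have tB : t 0 1 = Bt w xi mu by rewrite mxE.
have sE : s 0 0 = Et w xi mu by rewrite mxE.
have -> : F *m tmx w xi mu 0 0 *m invmx F = t 0 0 by rewrite mxE.
move/matrixP: (st) => /(_ 0 0); move/matrixP: st => /(_ 0 1).
rewrite !mul2E ![1%:M _ _]mxE /= sE tB tC tD -!mulmxE => e01 e00.
have uD := Dt_unit uw nz.
(* The entry (0,1) of [s *m t = 1%:M] is solved for [s 0 1], as $\tilde D$ is invertible;
   substituted into the entry (0,0) it produces the Schur complement. *)
have {e01} es : s 0 1 = - (Et w xi mu *m Bt w xi mu *m invmx (Dt w xi mu)).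
  apply: (can_inj (mulmxK uD)); rewrite mulNmx mulmxKV //.
  by apply/eqP; rewrite -addr_eq0 addrC; apply/eqP.
have {e00} : Et w xi mu *m (t 0 0 - Bt w xi mu *m invmx (Dt w xi mu) *m Ct w xi
  mu) = 1%:M.
  by rewrite mulmxBr -[RHS]e00 es mulNmx !mulmxA.
have EK : tensor_op (fun i => diag2 1 (1 / bm w (xi i) mu)) *m Et w xi mu =
  1%:M.
  by apply: tensor_diag_inv => i; rewrite ?mulr1 // div1r mulVf.
move/(congr1 (mulmx (tensor_op (fun i => diag2 1 (1 / bm w (xi i) mu))))).
rewrite mulmxA EK mul1mx mulmx1 => e.
by apply/eqP; rewrite -subr_eq; apply/eqP.
Qed.

Section Induction.
Variables (n : nat) (xi : 'I_n.+1 -> Lam).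
Let xi' := xi \o lift ord0.
Let nu := xi ord0.
Hypothesis bm_neq0 : forall i j : 'I_n.+1, i != j -> bm w (xi i) (xi j) != 0.
Variable F : opr K 'I_n.
Hypotheses (uF : F \in unitmx) (dF : diagonalizes xi' F).
Variable F1 : opr K 'I_n.+1.
Hypothesis hF1 : hsplit F1 = F%:M *m hsplit (Fpart w xi ord0).

Let f := conjmx_by uF.
Let t mu := map_mx f (tmx w xi' mu).
Let s mu := map_mx f (tmx_inv w xi' mu).
(** The factor $\mathcal F_{1,2\dots L}$ conjugated by [F], so that [hsplit F1] is [P *m F%:M]. By
    the induction hypothesis its rows are $1,0$ and $\tilde C'(\xi_1),\tilde D'(\xi_1)$. *)
Let P : 'M[opr K 'I_n]_2 := map_mx f (hsplit (Fpart w xi ord0)).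

Let tD mu : t mu 1 1 = Dt w xi' mu. Proof. by rewrite mxE; case: (dF mu). Qed.
Let tC mu : t mu 1 0 = Ct w xi' mu. Proof. by rewrite mxE; case: (dF mu). Qed.
Let tB mu : t mu 0 1 = Bt w xi' mu. Proof. by rewrite mxE; case: (dF mu). Qed.
Let sE mu : s mu 0 0 = Et w xi' mu. Proof. by rewrite mxE; case: (dF mu). Qed.

Let PE : (P 0 0 = 1%:M) * (P 0 1 = 0) * (P 1 0 = Ct w xi' nu) * (P 1 1 = Dt w
  xi' nu).
Proof.
have [e0 e1 e2] := hsplit_Fpart0 w xi.
rewrite /P; do ![split]; rewrite mxE ?e0 ?e1 ?e2.
- exact: conjmx_by_scalar.
- exact: raddf0.
- by rewrite -tC mxE.
by rewrite -tD mxE.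
Qed.

Let hF1_conj X : hsplit (F1 *m X) = P *m map_mx f (hsplit X) *m F%:M.
Proof.
rewrite hsplit_multiplicative hF1.
apply/matrixP => k l; rewrite mul_mx_scalarE -map_mxM [in RHS]mxE /= -!mulmxE.
by rewrite -conjmx_byE -mulmxA mul_scalar_mxE.
Qed.

Let hF1_right Y : hsplit (Y *m F1) = hsplit Y *m P *m F%:M.
Proof.
rewrite hsplit_multiplicative hF1 -mulmxE -mulmxA; congr (_ *m _).
by apply/matrixP => k l;
  rewrite mul_mx_scalarE mul_scalar_mxE [P _ _]mxE -!mulmxE conjmx_byE.
Qed.

Let unit_F1 : F1 \in unitmx.
Proof.
have uD : Dt w xi' nu \in unitmx by apply: (Dt_unit uw) => i; apply: bm_0S.
(* The inverse of a lower triangular 2 x 2 block matrix with diagonal $1,\tilde D'(\xi_1)$. *)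
pose Q : 'M[opr K 'I_n]_2 := \matrix_(k, l)
  if k == 0 then (if l == 0 then 1%:M else 0)
  else if l == 0 then - (invmx (Dt w xi' nu) *m Ct w xi' nu)
  else invmx (Dt w xi' nu).
have PQ : P *m Q = 1%:M.
  apply: matrix2P; rewrite mul2E !PE !mxE /= -!mulmxE ?mul1mx ?mul0mx ?mulmx0
    ?mulmx1 ?addr0 ?add0r //.
    by rewrite mulmxN mulmxA mulmxV // mul1mx subrr.
  by rewrite mulmxV.
have Q1 : F1 *m hjoin ((invmx F)%:M *m Q) = 1%:M.
  apply: hsplit_inj; rewrite hsplit_multiplicative hjoinK.
  have -> : hsplit F1 = P *m F%:M by rewrite -[F1]mul1mx hF1_right
    hsplit_multiplicative mul1mx.
  rewrite hsplit_multiplicative -[RHS]PQ -mulmxE -mulmxA; congr (_ *m _).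
  by rewrite mulmxA -scalar_mxM -mulmxE mulmxV // mul1mx.
by case: (mulmx1_unit Q1).
Qed.

Let conj_hsplit_tmx mu k l p q :
  map_mx f (hsplit (tmx w xi mu k l)) p q
  = \sum_m Rw w mu nu m p l q *: t mu k m.
Proof.
rewrite mxE hsplit_tmx /f raddf_sum; apply: eq_bigr => m _ /=.
by rewrite conjmx_byZ [t mu k m]mxE.
Qed.

Let conj_hsplit_tmx_inv mu k l p q :
  map_mx f (hsplit (tmx_inv w xi mu k l)) p q
  = \sum_m Rw w nu mu p k q m *: s mu m l.
Proof.
rewrite mxE hsplit_tmx_inv /f raddf_sum; apply: eq_bigr => m _ /=.
by rewrite conjmx_byZ [s mu m l]mxE.
Qed.

Let rtt_t x y : rtt (Lmx w x y) (t x) (t y).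
Proof. by apply: rtt_map (rtt_tmx _ _ _) => c; apply: conjmx_by_scalar. Qed.

(** After splitting, [F1 *m X] and [Y *m F1] both end in the factor [F%:M], so a twisting formula
    reduces to four block identities between twisted operators on the remaining sites. *)
Let twist_step X Y :
  P *m map_mx f (hsplit X) = hsplit Y *m P -> F1 *m X *m invmx F1 = Y.
Proof.
move=> e; apply: (can_inj (mulmxK unit_F1)); rewrite mulmxKV ?unit_F1 //.
by apply: hsplit_inj; rewrite hF1_conj hF1_right e.
Qed.

Let step_D mu : F1 *m tmx w xi mu 1 1 *m invmx F1 = Dt w xi mu.
Proof.
apply: twist_step; have [e00 e01 e10 e11] := hsplit_Dt w xi mu.
apply: matrix2P; rewrite !mul2E !PE ?e00 ?e01 ?e10 ?e11 -!mulmxE;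
  rewrite !conj_hsplit_tmx !sum2 !Rw_val ?scale0r
    ?(addr0, add0r, mul0mx, mulmx0, mul1mx, mulmx1).
- by rewrite tD.
- by [].
(* Block (1,0) is the exchange relation of $D(\mu)$ with $C(\xi_1)$. *)
- rewrite -!scalemxAr -scalemxAl -!tC -!tD addrC.
  by rewrite -(rtt_DC (rtt_t mu nu)).
by rewrite tD -scalemxAr -scalemxAl Dt_comm.
Qed.

Let step_C mu : F1 *m tmx w xi mu 1 0 *m invmx F1 = Ct w xi mu.
Proof.
apply: twist_step; have [e00 e01 e10 e11] := hsplit_Ct w xi mu.
apply: matrix2P; rewrite !mul2E !PE ?e00 ?e01 ?e10 ?e11 -!mulmxE;
  rewrite !conj_hsplit_tmx !sum2 !Rw_val ?scale0r
    ?(addr0, add0r, mul0mx, mulmx0, mul1mx, mulmx1) ?scale1r.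
(* The upper row rests on the identities for [CX] and [CG], the lower row on exchange relations of
   $C(\mu)$ with $C(\xi_1)$ and $D(\xi_1)$. *)
- by rewrite tC -scalemxAl; apply: Ct_split.
- by rewrite tD -scalemxAl CG_Dt.
- by rewrite -scalemxAl -!tC -(rtt_CC (rtt_t mu nu)).
rewrite -!scalemxAr -scalemxAl -!tC -!tD addrC.
by rewrite -(rtt_CD (rtt_t mu nu)).
Qed.

Let step_E mu : F1 *m tmx_inv w xi mu 0 0 *m invmx F1 = Et w xi mu.
Proof.
apply: twist_step; have [e00 e01 e10 e11] := hsplit_Et w xi mu.
apply: matrix2P; rewrite !mul2E !PE ?e00 ?e01 ?e10 ?e11 -!mulmxE;
  rewrite !conj_hsplit_tmx_inv !sum2 !Rw_val ?scale0r
    ?(addr0, add0r, mul0mx, mulmx0, mul1mx, mulmx1) ?scale1r.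
- by rewrite sE.
- by [].
(* Block (1,0) is the exchange relation between the row $C,D$ at $\xi_1$ and the inverse monodromy
   matrix at $\mu$. *)
- have st : s mu *m t mu = 1%:M /\ t mu *m s mu = 1%:M.
    have [e e'] := chainK xi' uw (rev (enum 'I_n)) mu.
    by rewrite -!map_mxM /= e e' map_mx1.
  rewrite -!scalemxAr -scalemxAl -!tC -!tD -sE.
  by rewrite -(rtt_inv_AC (rtt_t mu nu) uw st.1 st.2).
by rewrite sE -scalemxAr -scalemxAl Dt_Et_comm.
Qed.

Let step_B mu : F1 *m tmx w xi mu 0 1 *m invmx F1 = Bt w xi mu.
Proof.
apply: twist_step; have [e00 e01 e10 e11] := hsplit_Bt w xi mu.
apply: matrix2P; rewrite !mul2E !PE ?e00 ?e01 ?e10 ?e11 -!mulmxE;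
  rewrite !conj_hsplit_tmx !sum2 !Rw_val ?scale0r
    ?(addr0, add0r, mul0mx, mulmx0, mul1mx, mulmx1).
- by rewrite tB.
- by [].
- rewrite -!scalemxAr -scalemxAl tB.
  have uD : Dt w xi' nu \in unitmx by apply: (Dt_unit uw) => i; apply: bm_0S.
  have eY : BY w xi mu = Dt w xi' nu *m Bt w xi' mu *m invmx (Dt w xi' nu).
    by rewrite (Dt_Bt _ bm_neq0) mulmxK.
  have eG : Dt w xi' mu *m tensor_op (fun i => diag2 1 (1 / bm w (xi' i) nu)) =
    BG w xi mu.
    by rewrite tensor_diag_mul; apply: eq_tensor => i; rewrite mulr1 div1r.
  have eA : t nu 0 0 = tensor_op (fun i => diag2 1 (1 / bm w (xi' i) nu))
      + Bt w xi' nu *m invmx (Dt w xi' nu) *m Ct w xi' nu.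
    rewrite mxE; apply: twisted_A => // i; [exact: bm_0S | exact: bm_S0].
  (* No formula is at hand for $\tilde A'(\mu)$, as nothing is assumed on $\mu$. This relation
     trades $D(\xi_1)A(\mu)$ for $D(\mu)A(\xi_1)$, and A at $\xi_1$ is given by [eA]. *)
  have := rtt_BC (rtt_t mu nu); rewrite tB tC tD tD addrC eA mulmxDr eG => eBC.
  have := rtt_BD (rtt_t mu nu); rewrite !tB !tD => eBD.
  rewrite addrC -eBC eY scalerDr -addrA; congr (_ + _).
  rewrite -/nu.
  (* With the [BG] terms cancelled, what remains is the relation [eBD] multiplied on the right by
     $\tilde D'(\xi_1)^{-1}\tilde C'(\xi_1)$. *)
  set Z := RHS; have -> : Z = am w mu nu *: (Dt w xi' nu *m Bt w xi' mu)
      *m invmx (Dt w xi' nu) *m Ct w xi' nu by rewrite -!scalemxAl.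
  rewrite -eBD !mulmxA.
  by rewrite !mulmxDl -!scalemxAl (mulmxK uD) addrC.
by rewrite tB -scalemxAr -scalemxAl (Dt_Bt _ bm_neq0).
Qed.

Lemma diagonalizesS : F1 \in unitmx /\ diagonalizes xi F1.
Proof. by split; [exact: unit_F1 | split]. Qed.
End Induction.

Lemma Fall_diagonalizes n (xi : 'I_n -> Lam) :
    (forall i j, i != j -> bm w (xi i) (xi j) != 0) ->
  Fall w xi \in unitmx /\ diagonalizes xi (Fall w xi).
Proof.
elim: n xi => [|n IH] xi bm_neq0; last first.
  have [|uF dF] := IH (xi \o lift ord0).
    by move=> i j neq_ij; apply: bm_neq0; rewrite (inj_eq lift_inj).
  exact: diagonalizesS dF _ (hsplit_Fall w xi).
(* The induction starts at the empty chain, where every tensor product is the identity and the sums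
   over l are empty. *)
have enum0 : enum 'I_0 = [::] by apply: size0nil; rewrite size_enum_ord.
have F1 : Fall w xi = 1%:M by rewrite /Fall enum0 /rev /= big_nil.
rewrite F1; split=> [|mu]; first exact: unitmx1.
have tensor0 (M : 'I_0 -> 'M[K]_2) : tensor_op M = 1%:M.
  by rewrite -tensor1; apply: eq_tensor => -[].
have e : tmx w xi mu = 1%:M by rewrite /tmx /chain enum0 /rev /= big_nil.
have e' : tmx_inv w xi mu = 1%:M by rewrite /tmx_inv /chain_inv enum0 /rev /=
  big_nil.
rewrite e e' invmx1 !mulmx1 !mul1mx !mxE /= /Dt /Et !tensor0 /Ct /Bt !big_ord0.
by split.
Qed.

End Twist.

(** * Transfer to the operators A, B, C, D of the model *)

Theorem mainTheorem2 (R : realType) (Lam : Type) (w : weights Lam R[i])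
    (w_unitary : unitarity w) (w_yang_baxter : yang_baxter w)
    (L : nat) (L_ge2 : (2 <= L)%N) (xi : 'I_L -> Lam) (mu : Lam)
    (bm_neq0 : forall i j : 'I_L, i != j -> bm w (xi i) (xi j) != 0) :
  let tA := twisted w xi (opA w xi mu) in
  let tB := twisted w xi (opB w xi mu) in
  let tC := twisted w xi (opC w xi mu) in
  let tD := twisted w xi (opD w xi mu) in
  [/\ tD = tensor_op (fun i => diag2 (bm w mu (xi i)) (am w mu (xi i))),
      tC = \sum_(l < L) cm w mu (xi l) *:
        tensor_op (fun i : 'I_L =>
          if (i < l)%N then
            diag2 (bm w mu (xi i) / bm w (xi l) (xi i)) (am w mu (xi i))
          else if i == l then e12 R[i]
          else
            diag2 (bm w mu (xi i) / bm w (xi l) (xi i))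
                  (am w mu (xi i) / am w (xi l) (xi i))),
      tB = \sum_(l < L) cp w mu (xi l) *:
        tensor_op (fun i : 'I_L =>
          if (i < l)%N then
            diag2 (bm w mu (xi i))
                  (am w mu (xi i) * am w (xi i) (xi l) / bm w (xi i) (xi l))
          else if i == l then e21 R[i]
          else
            diag2 (bm w mu (xi i)) (am w mu (xi i) / bm w (xi i) (xi l)))
    & (forall i : 'I_L, bm w mu (xi i) != 0 /\ bm w (xi i) mu != 0) ->
      tA = tensor_op (fun i => diag2 1 (1 / bm w (xi i) mu))
           + tB *m invmx tD *m tC].
Proof.
have [uF dF] := Fall_diagonalizes w_unitary w_yang_baxter bm_neq0.
have twistedE k l Y : Fall w xi *m tmx w xi mu k l *m invmx (Fall w xi) = Y ->
    twisted w xi (aux_block (monodromy w xi mu) k l) = Y.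
  by move=> <-; rewrite /twisted Ftwist_Fall aux_block_monodromy.
have [eD eC eB _] := dF mu.
move=> tA tB tC tD.
have hD : tD = Dt w xi mu := twistedE _ _ _ eD.
have hC : tC = Ct w xi mu := twistedE _ _ _ eC.
have hB : tB = Bt w xi mu := twistedE _ _ _ eB.
have hA (nz : forall i, bm w mu (xi i) != 0 /\ bm w (xi i) mu != 0) :
    tA = tensor_op (fun i => diag2 1 (1 / bm w (xi i) mu))
         + Bt w xi mu *m invmx (Dt w xi mu) *m Ct w xi mu.
  by apply: twistedE; apply: (twisted_A w_unitary uF dF) => i; case: (nz i).
clearbody tA tB tC tD; rewrite hD hC hB.
exact: And4 erefl erefl erefl hA.
Qed.
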